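(* For every metric space $X$ and every integer $n \ge 0$, the following assertions are equivalent: (1) $X$ is $(n,\ast)$-hyperbolic; (2) the injective hull $E(X)$ is $(n,\ast)$-hyperbolic; (3) $\operatorname{asrk}(E(X)) \le n$; (4) there is a constant $r_0$ such that $E(X)$ contains no isometric copy of the ball $B(0,r) = [-r,r]^{n+1} \subset l_\infty^{\,n+1}$ for $r > r_0$.
   Context: $l_\infty^{\,m} := (\mathbb{R}^m,\|\cdot\|_\infty)$. An isometric copy of $A$ in $Y$ is the image of a distance-preserving map $A\to Y$. Hyperbolicity: let $n\ge 0$ be an integer and $I_n=\{\pm1,\ldots,\pm(n+1)\}$ (a set with $2(n+1)$ elements). For $\delta\ge 0$, a metric space $(X,d)$ is $(n,\delta)$-hyperbolic if for every family $(x_i)_{i\in I_n}$ of points of $X$ there is a permutation $\alpha\ne-\mathrm{id}$ of $I_n$ with $\sum_{i\in I_n}d(x_i,x_{-i})\le\sum_{i\in I_n}d(x_i,x_{\alpha(i)})+2\delta$. $X$ is $(n,\ast)$-hyperbolic if it is $(n,\delta)$-hyperbolic for some $\delta\ge 0$. Injective hull: a metric space $Y$ is injective if every $1$-Lipschitz map $A\to Y$ defined on a subset $A$ of a metric space $B$ extends to a $1$-Lipschitz map $B\to Y$. The injective hull $E(X)$ of $(X,d)$ is the set of all functions $f:X\to\mathbb{R}$ that are minimal, in the pointwise order, among the functions satisfying $f(x)+f(y)\ge d(x,y)$ for all $x,y\in X$; it is endowed with the (finite) metric $\|f-g\|_\infty=\sup_X|f-g|$, and $x\mapsto d(\cdot,x)$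 is the canonical isometric embedding $X\to E(X)$. $E(X)$ is injective, and every isometric embedding of $X$ into an injective metric space factors through $E(X)$ via an isometric embedding. Asymptotic rank: a compact metric space $Z$ is an asymptotic subset of a metric space $(Y,d)$ if there are a sequence $0<r_k\to\infty$ and subsets $Z_k\subset Y$ such that the rescaled sets $(Z_k,r_k^{-1}d)$ converge to $Z$ in the Gromov–Hausdorff topology. $\operatorname{asrk}(Y)$ is the supremum of all integers $m\ge0$ for which there exists an asymptotic subset of $Y$ that is bi-Lipschitz homeomorphic to a compact subset of $\mathbb{R}^m$ with positive Lebesgue measure. *)

(* Defs.v *)
From HB Require Import structures.
From mathcomp Require Import all_boot all_order all_algebra.
From mathcomp Require Import perm.
From mathcomp Require Import all_classical all_reals all_analysis.

Set Implicit Arguments.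
Unset Strict Implicit.
Unset Printing Implicit Defensive.
Import Order.TTheory GRing.Theory Num.Theory.
Import numFieldNormedType.Exports.
Local Open Scope classical_set_scope.
Local Open Scope ring_scope.

(* [(k, true)] and [(k, false)] stand for [k + 1] and [- (k + 1)]. *)
Definition sgn_index (n : nat) : finType := ('I_n.+1 * bool)%type.

Definition sgn_opp (n : nat) (i : sgn_index n) : sgn_index n := (i.1, ~~ i.2).

Lemma sgn_opp_inj (n : nat) : injective (@sgn_opp n).
Proof. by move=> [i b] [j c] [-> /negb_inj ->]. Qed.

Definition hyperbolic (R : realType) (n : nat) (delta : R) (X : metricType R) :=
  forall x : sgn_index n -> X,
  exists2 alpha : {perm sgn_index n}, alpha <> perm (@sgn_opp_inj n) &
    \sum_i mdist (x i) (x (sgn_opp i)) <=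
    \sum_i mdist (x i) (x (alpha i)) + 2 * delta.

Definition star_hyperbolic (R : realType) (n : nat) (X : metricType R) :=
  exists2 delta : R, 0 <= delta & hyperbolic n delta X.

Section injective_hull.
Context {R : realType} (X : metricType R).
Implicit Types f g : X -> R.

Definition dominates_dist f := forall x y, mdist x y <= f x + f y.

Definition extremal f := dominates_dist f /\
  forall g, dominates_dist g -> (forall x, g x <= f x) -> g = f.

Record injective_hull := InjectiveHull {
  hull_fun :> X -> R ;
  hull_extremal : extremal hull_fun }.

HB.instance Definition _ := gen_eqMixin injective_hull.
HB.instance Definition _ := gen_choiceMixin injective_hull.

Lemma dominates_dist_ge0 f x : dominates_dist f -> 0 <= f x.
Proof. by move=> /(_ x x); rewrite mdistxx -mulr2n pmulrn_lge0. Qed.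

Lemma extremal_lip f x y : extremal f -> f x <= f y + mdist x y.
Proof.
move=> [df minf]; rewrite leNgt; apply/negP => lt_fx.
pose g z := if z == x then f y + mdist x y else f z.
have gx : g x = f y + mdist x y by rewrite /g eqxx.
have g_le z : g z <= f z by rewrite /g; case: eqP => // ->; exact: ltW.
have gx_dist z : mdist x z <= g x + f z.
  rewrite gx addrAC addrC (le_trans (metric_triangle x y z))// lerD2l.
  exact: df.
have dg : dominates_dist g.
  move=> u v; have [->|ux] := eqVneq u x; have [->|vx] := eqVneq v x.
  - rewrite mdistxx gx addr_ge0// addr_ge0 ?mdist_ge0//;
      exact: dominates_dist_ge0.
  - by have := gx_dist v; rewrite {3}/g (negbTE vx).
  - by have := gx_dist u; rewrite metric_sym addrC {2}/g (negbTE ux).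
  - by rewrite /g (negbTE ux) (negbTE vx); exact: df.
by move: lt_fx; rewrite -gx (minf _ dg g_le) ltxx.
Qed.

Definition hull_dist (f g : injective_hull) : R :=
  sup [set `|f x - g x| | x in [set: X]].

Lemma hull_dist_ub (f g : injective_hull) :
  has_ubound [set `|f x - g x| | x in [set: X]].
Proof.
have [[x0 _]|X0] := pselect ([set: X] !=set0); last first.
  by exists 0 => y [z _ _]; exfalso; apply: X0; exists z.
suff bnd (h k : injective_hull) x : h x - k x <= h x0 + k x0.
  exists (f x0 + g x0) => _ [x _ <-].
  by rewrite ler_norml bnd andbT lerNl opprB [leRHS]addrC bnd.
have hx := extremal_lip x x0 (hull_extremal h).
have kx : mdist x x0 <= k x + k x0 by have [dk _] := hull_extremal k; exact: dk.
by rewrite lerBlDr (le_trans hx)// -addrA lerD2l [leRHS]addrC.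
Qed.

Lemma hull_dist_ge (f g : injective_hull) x : `|f x - g x| <= hull_dist f g.
Proof. by apply: ub_le_sup; [exact: hull_dist_ub|exists x]. Qed.

Lemma hull_dist_le (f g : injective_hull) (c : R) :
  0 <= c -> (forall x, `|f x - g x| <= c) -> hull_dist f g <= c.
Proof.
move=> c0 fgc; rewrite /hull_dist; set S := (X in sup X).
have [[s Ss]|S0] := pselect (S !=set0).
  by apply: ge_sup; [exists s|move=> _ [x _ <-]].
have -> : S = set0 by apply/eqP; apply/negPn/negP => /set0P.
by rewrite sup0.
Qed.

Lemma hull_dist_ge0 (f g : injective_hull) : 0 <= hull_dist f g.
Proof.
rewrite /hull_dist; set S := (X in sup X).
have [[_ [x _ _]]|S0] := pselect (S !=set0).
  exact: le_trans (normr_ge0 _) (hull_dist_ge f g x).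
have -> : S = set0 by apply/eqP; apply/negPn/negP => /set0P.
by rewrite sup0.
Qed.

Lemma hull_distxx (f : injective_hull) : hull_dist f f = 0.
Proof.
apply/eqP; rewrite eq_le hull_dist_ge0 andbT.
by apply: hull_dist_le => // x; rewrite subrr normr0.
Qed.

Lemma hull_dist_positivity (f g : injective_hull) : hull_dist f g = 0 -> f = g.
Proof.
move=> fg0; have fg x : hull_fun f x = g x.
  apply/eqP; rewrite -subr_eq0 -normr_le0 -fg0; exact: hull_dist_ge.
move: f g fg {fg0} => [f ef] [g eg] /= /funext fg.
by rewrite fg in ef *; congr InjectiveHull; exact: Prop_irrelevance.
Qed.

Lemma hull_dist_sym (f g : injective_hull) : hull_dist f g = hull_dist g f.
Proof.
by congr sup; apply: eq_imagel => x _; rewrite distrC.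
Qed.

Lemma hull_dist_triangle (g f h : injective_hull) :
  hull_dist f h <= hull_dist f g + hull_dist g h.
Proof.
apply: hull_dist_le => [|x]; first by rewrite addr_ge0 ?hull_dist_ge0.
by rewrite (le_trans (ler_distD (g x) _ _))// lerD ?hull_dist_ge.
Qed.

HB.instance Definition _ := isMetric.Build R injective_hull
  hull_distxx hull_dist_positivity hull_dist_sym hull_dist_triangle.

End injective_hull.

(* The metric space [(Y, r^-1 d)]. *)
Definition rescaled (R : realType) (r : {posnum R}) (Y : metricType R) : Type :=
  Y.

Section rescaled_metric.
Context {R : realType} (r : {posnum R}) (Y : metricType R).

HB.instance Definition _ := Choice.on (rescaled r Y).

Definition rescaled_dist (x y : rescaled r Y) : R :=
  r%:num^-1 * mdist (x : Y) (y : Y).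

Lemma rescaled_distxx x : rescaled_dist x x = 0.
Proof. by rewrite /rescaled_dist mdistxx mulr0. Qed.

Lemma rescaled_dist_positivity x y : rescaled_dist x y = 0 -> x = y.
Proof.
by move=> /eqP; rewrite mulf_eq0 invr_eq0 gt_eqF//= => /eqP/mdist_positivity.
Qed.

Lemma rescaled_dist_sym x y : rescaled_dist x y = rescaled_dist y x.
Proof. by rewrite /rescaled_dist metric_sym. Qed.

Lemma rescaled_dist_triangle y x z :
  rescaled_dist x z <= rescaled_dist x y + rescaled_dist y z.
Proof. by rewrite -mulrDr ler_wpM2l// metric_triangle. Qed.

HB.instance Definition _ := isMetric.Build R (rescaled r Y)
  rescaled_distxx rescaled_dist_positivity
  rescaled_dist_sym rescaled_dist_triangle.

End rescaled_metric.

Section gromov_hausdorff.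
Context {R : realType}.

Definition hausdorff_dist (W : metricType R) (A B : set W) : \bar R :=
  ereal_inf [set e%:E | e in [set e : R | [/\ 0 < e,
    A `<=` \bigcup_(b in B) ball b e & B `<=` \bigcup_(a in A) ball a e]]].

Definition isometric_on (Y W : metricType R) (A : set Y) (f : Y -> W) :=
  forall x y, A x -> A y -> mdist (f x) (f y) = mdist x y.

(* The Gromov-Hausdorff distance between the metric subspaces [A] of [Y] and
   [B] of [Z]. *)
Definition gh_dist (Y Z : metricType R) (A : set Y) (B : set Z) : \bar R :=
  ereal_inf [set e | exists (W : metricType R) (f : Y -> W) (g : Z -> W),
    [/\ isometric_on A f, isometric_on B g &
        e = hausdorff_dist (f @` A) (g @` B)]].

Definition asymptotic_subset (Y Z : metricType R) :=
  compact [set: Z] /\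
  exists (r : nat -> {posnum R}) (A : nat -> set Y),
    (r k)%:num @[k --> \oo] --> +oo /\
    gh_dist (A k : set (rescaled (r k) Y)) [set: Z] @[k --> \oo] --> 0%E.

End gromov_hausdorff.

Lemma sigma_finite_prod d1 d2 (T1 : measurableType d1)
    (T2 : measurableType d2) (R : realType)
    (m1 : {sigma_finite_measure set T1 -> \bar R})
    (m2 : {sigma_finite_measure set T2 -> \bar R}) :
  sigma_finite [set: T1 * T2] (m1 \x m2)%E.
Proof.
have /sigma_finiteP[F [FT ndF Foo]] := sigma_finiteT m1.
have /sigma_finiteP[G [GT ndG Goo]] := sigma_finiteT m2.
exists (fun k => F k `*` G k).
  rewrite -setXTT FT GT; apply/seteqP; split=> [[x y]|[x y]].
    move=> [/= [i _ Fix] [j _ Gjy]]; exists (maxn i j) => //; split.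
    - by move: x Fix; exact/subsetPset/ndF/leq_maxl.
    - by move: y Gjy; exact/subsetPset/ndG/leq_maxr.
  by move=> [k _ []/= ? ?]; split; exists k.
move=> k; have [mF Fk] := Foo k; have [mG Gk] := Goo k.
split; first exact: measurableX.
by rewrite product_measure1E// lte_mul_pinfty// ge0_fin_numE.
Qed.

Section lebesgue_measure_Rn.
Context {R : realType}.

Section step.
Context (m : nat).
Variable mu : {sigma_finite_measure set (m.-tuple (measurableTypeR R)) -> \bar R}.

Definition tuple_cons (p : measurableTypeR R * m.-tuple (measurableTypeR R)) :
  m.+1.-tuple (measurableTypeR R) := [tuple of p.1 :: p.2].

Definition tuple_uncons (t : m.+1.-tuple (measurableTypeR R)) :
  measurableTypeR R * m.-tuple (measurableTypeR R) :=
  (tnth t ord0, [tuple of behead t]).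

Lemma tuple_consK : cancel tuple_cons tuple_uncons.
Proof. by move=> [x t]; congr pair; exact: val_inj. Qed.

Lemma tuple_unconsK : cancel tuple_uncons tuple_cons.
Proof. by move=> t; rewrite [RHS]tuple_eta; exact: val_inj. Qed.

Lemma measurable_tuple_cons : measurable_fun [set: _] tuple_cons.
Proof. exact: measurable_cons. Qed.

Lemma measurable_tuple_uncons : measurable_fun [set: _] tuple_uncons.
Proof.
apply/measurable_fun_pairP; split; first exact: measurable_tnth.
exact: measurable_behead.
Qed.

Definition lebesgue_step : set (m.+1.-tuple (measurableTypeR R)) -> \bar R :=
  pushforward (lebesgue_measure \x mu)%E tuple_cons.

Let mcons (A : set (m.+1.-tuple (measurableTypeR R))) :
  measurable A -> measurable (tuple_cons @^-1` A).
Proof.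
by move=> mA; rewrite -[X in measurable X]setTI; exact: measurable_tuple_cons.
Qed.

Let lebesgue_step0 : lebesgue_step set0 = 0%E.
Proof. by rewrite /lebesgue_step /pushforward preimage_set0 measure0. Qed.

Let lebesgue_step_ge0 A : (0 <= lebesgue_step A)%E.
Proof. by rewrite /lebesgue_step /pushforward; exact: measure_ge0. Qed.

Let lebesgue_step_sigma_additive : semi_sigma_additive lebesgue_step.
Proof.
move=> F mF tF mUF; rewrite /lebesgue_step /pushforward preimage_bigcup.
apply: measure_semi_sigma_additive.
- by move=> n; exact: mcons.
- apply/trivIsetP => /= i j _ _ ij; rewrite -preimage_setI.
  by move/trivIsetP : tF => /(_ _ _ _ _ ij) ->//; rewrite preimage_set0.
- by rewrite -preimage_bigcup; exact: mcons.
Qed.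

HB.instance Definition _ := isMeasure.Build _ _ _ lebesgue_step
  lebesgue_step0 lebesgue_step_ge0 lebesgue_step_sigma_additive.

Let lebesgue_step_sigma_finite : sigma_finite [set: _] lebesgue_step.
Proof.
have [F FT Foo] : sigma_finite [set: _] (@lebesgue_measure R \x mu)%E.
  exact: sigma_finite_prod.
exists (fun k => tuple_uncons @^-1` F k).
  by rewrite -preimage_bigcup -FT preimage_setT.
move=> k; have [mF Fk] := Foo k; split.
  by rewrite -[X in measurable X]setTI; exact: measurable_tuple_uncons.
rewrite /lebesgue_step /pushforward -comp_preimage.
by rewrite (_ : _ \o _ = id)//; apply/funext => p /=; rewrite tuple_consK.
Qed.

HB.instance Definition _ := Measure_isSigmaFinite.Build _ _ _ lebesgue_step
  lebesgue_step_sigma_finite.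

End step.

(* The [m]-fold product of [lebesgue_measure]; the library has no Lebesgue
   measure in dimension other than 1. *)
Fixpoint lebesgue_tuple (m : nat) :
    {sigma_finite_measure set (m.-tuple (measurableTypeR R)) -> \bar R} :=
  match m with
  | 0 => \d_([tuple])
  | m'.+1 => lebesgue_step (lebesgue_tuple m')
  end.

Definition lebesgue_Rn (m : nat) (K : set 'rV[R]_m) : \bar R :=
  lebesgue_tuple m [set t | K (\row_i tnth t i)].

End lebesgue_measure_Rn.

Section asymptotic_rank.
Context {R : realType}.

Definition euclidean_norm (m : nat) (u : 'rV[R]_m) : R :=
  Num.sqrt (\sum_i u 0 i ^+ 2).

Definition bilipschitz_homeomorphic (Z : metricType R) (m : nat)
    (K : set 'rV[R]_m) :=
  exists f : Z -> 'rV[R]_m, f @` [set: Z] = K /\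
  exists2 L : R, 0 < L & forall x y : Z,
    L^-1 * mdist x y <= euclidean_norm (f x - f y) <= L * mdist x y.

Definition asrk (Y : metricType R) : \bar R :=
  ereal_sup [set m%:R%:E | m in [set m : nat |
    exists (Z : metricType R) (K : set 'rV[R]_m),
      [/\ asymptotic_subset Y Z, compact K, (0 < lebesgue_Rn K)%E &
          bilipschitz_homeomorphic Z K]]].

(* The norm of the library on ['rV_m] is the maximum norm. *)
Definition contains_linfty_ball (m : nat) (r : R) (Y : metricType R) :=
  exists f : 'rV[R]_m -> Y, forall u v : 'rV[R]_m,
    (forall i, - r <= u 0 i <= r) -> (forall i, - r <= v 0 i <= r) ->
    mdist (f u) (f v) = `|u - v|.

End asymptotic_rank.

(* Main.v *)
(* Let [E] be the injective hull of [X].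

   (1) <-> (2): [X] embeds into [E], and distances in [E] are attained up to
   [e]: [|f - g| <= d x y - f x - g y + e] for suitable points of [X], so that
   a hyperbolicity inequality for these points gives one in [E].

   (4) -> (1): if [- id] beats all other permutations by [2 * delta] on some
   family of points, then linear programming duality for the assignment problem
   gives [f] with [f i + f j >= d (x i) (x j) + delta / (n + 1)], except for
   [j = - i] where [f i + f j = d (x i) (x j)]. Moving the values of [f] on the
   pairs [+- k] in opposite directions gives an [l_infty] cube of extremal
   functions on the family, which a 1-Lipschitz retraction onto [E] extends to
   [X].

   (2) -> (3): a compact set of positive measure fills some cube up to an
   arbitrarily fine mesh, so an asymptotic subset of rank [m > n] yields in the
   limit a metric [d] on [R^m] that is bi-Lipschitz to the Euclidean one and
   [(n, 0)]-hyperbolic. Such metrics are stable under translations, rescalings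
   and ultralimits. Maximizing [d x y / |x - y|] over all of them produces a
   metric with [w * |<e, x - y>| <= d x y <= w * |x - y|] for a unit vector [e];
   iterating this in the orthogonal complement gives orthonormal [e_0, ..., e_n],
   and the points [+- e_k] violate hyperbolicity. *)
Require Import Defs.
From HB Require Import structures.
From mathcomp Require Import all_boot all_order all_algebra.
From mathcomp Require Import perm.
From mathcomp Require Import all_classical all_reals all_analysis.
From mathcomp Require Import ring lra zify.
Set Implicit Arguments.
Unset Strict Implicit.
Unset Printing Implicit Defensive.
Import Order.TTheory GRing.Theory Num.Theory.
Import numFieldNormedType.Exports.
Local Open Scope classical_set_scope.
Local Open Scope ring_scope.

(** * The hull and its hyperbolicity *)

Section extremal_functions.
Context {R : realType} (X : metricType R).
Implicit Types f g : X -> R.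

(** Otherwise [f x] alone could be lowered by [e / 2], half because the pair [(x, x)] counts the
    change twice, and [f] would not be minimal. *)
Lemma extremal_tight f x (e : R) : extremal f -> 0 < e ->
  exists y, f x + f y < mdist x y + e.
Proof.
move=> ef e0; apply: contrapT => /forallNP tight.
have {}tight y : mdist x y + e <= f x + f y by rewrite leNgt; exact/negP.
have [df minf] := ef.
pose g z := if z == x then f x - e / 2 else f z.
have g_le z : g z <= f z.
  by rewrite /g; case: eqP => // ->; rewrite gerBl divr_ge0// ltW.
have dg : dominates_dist g.
  move=> u v; rewrite /g; have [->|ux] := eqVneq u x; have [->|vx] := eqVneq v x.
  - by have := tight x; rewrite mdistxx; lra.
  - by have := tight v; lra.
  - by have := tight u; rewrite metric_sym; lra.
  - exact: df.
have /(congr1 (@^~ x)) := minf _ dg g_le.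
by rewrite /g eqxx => /eqP; rewrite eq_sym -subr_eq0 opprB addrC subrK; lra.
Qed.

Lemma tight_extremal f : dominates_dist f ->
  (forall x (e : R), 0 < e -> exists y, f x + f y < mdist x y + e) -> extremal f.
Proof.
move=> df tf; split=> // g dg gf; apply/funext => x; apply/eqP.
rewrite eq_le gf/=; apply/ler_addgt0Pr => e /(tf x)[y fxy].
by have := dg x y; have := gf y; lra.
Qed.

Lemma dist_extremal (x : X) : extremal (mdist x).
Proof.
apply: tight_extremal => [y z|y e e0].
  by rewrite (metric_sym x y) metric_triangle.
by exists x; rewrite mdistxx addr0 metric_sym ltrDl.
Qed.

Lemma hull_distE (f g : injective_hull X) : mdist f g = hull_dist f g.
Proof. by []. Qed.

(** Where [|f x - g x|] is almost maximal, the larger value, say [f x], is by tightness almost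
    [mdist x y - f y] for some [y]. Each approximation costs [e / 2]. *)
Lemma hull_dist_attained (f g : injective_hull X) (e : R) : X -> 0 < e ->
  exists x y, hull_dist f g < mdist x y - f x - g y + e.
Proof.
move=> x0 e0; have e2 : 0 < e / 2 by rewrite divr_gt0.
have S0 : [set `|f x - g x| | x in [set: X]] !=set0 by exists `|f x0 - g x0|, x0.
have [_ [x _ <-] fgx] := sup_adherent e2 (conj S0 (hull_dist_ub f g)).
rewrite -/(hull_dist f g) in fgx.
have [gf|fg] := leP (g x) (f x).
  have [y fy] := extremal_tight x (hull_extremal f) e2.
  exists y, x; rewrite metric_sym.
  by move: fgx; rewrite ger0_norm ?subr_ge0//; lra.
have [y gy] := extremal_tight x (hull_extremal g) e2.
exists x, y.
by move: fgx; rewrite ltr0_norm ?subr_lt0//; lra.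
Qed.

End extremal_functions.

Section hyperbolicity_hull.
Context {R : realType} (X : metricType R) (n : nat).

Lemma one_neq_sgn_opp : (1%g : {perm sgn_index n}) <> perm (@sgn_opp_inj n).
Proof.
by move=> /(congr1 (fun s : {perm _} => (s (ord0, true)).2)); rewrite !permE.
Qed.

Lemma sgn_oppK : involutive (@sgn_opp n).
Proof. by case=> i b; rewrite /sgn_opp/= negbK. Qed.

Lemma sum_sgn_index (F : sgn_index n -> R) :
  \sum_i F i = \sum_k (F (k, true) + F (k, false)).
Proof.
rewrite (eq_bigr (fun p => F (p.1, p.2))) => [|[]//].
rewrite -(pair_bigA _ (fun k b => F (k, b)))/=.
by apply: eq_bigr => k _; rewrite big_bool.
Qed.

Lemma star_hyperbolic_of_hull :
  star_hyperbolic n (injective_hull X) -> star_hyperbolic n X.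
Proof.
move=> [delta d0 hyp]; exists delta => // x.
pose k (y : X) := InjectiveHull (dist_extremal y).
have kE y z : mdist (k y) (k z) = mdist y z.
  apply/le_anti/andP; split.
    apply: hull_dist_le => [|w /=]; first exact: mdist_ge0.
    rewrite ler_norml; have := metric_triangle y z w.
    by have := metric_triangle z y w; rewrite (metric_sym z y); lra.
  have := hull_dist_ge (k y) (k z) z.
  by rewrite /= mdistxx subr0 ger0_norm ?mdist_ge0.
have [alpha alphaN le_alpha] := hyp (k \o x); exists alpha => //.
by move: le_alpha => /=; under eq_bigr do rewrite kE;
  under [in leRHS]eq_bigr do rewrite kE.
Qed.

(** Choose points [x i] that nearly realize the distances of the pairs [f i], [f (- i)]. The
    correction terms [f i (x i)] have the same total for every permutation, so they cancel. *)
Lemma star_hyperbolic_hull :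
  star_hyperbolic n X -> star_hyperbolic n (injective_hull X).
Proof.
move=> [delta d0 hyp].
have [[x0 _]|X0] := pselect ([set: X] !=set0); last first.
  (* For empty [X] all distances in the hull vanish, and any permutation other than [- id] works. *)
  exists 0 => // f; exists 1%g; first exact: one_neq_sgn_opp.
  have dist0 (g h : injective_hull X) : mdist g h = 0.
    apply/le_anti; rewrite mdist_ge0 andbT; apply: hull_dist_le => // z.
    by exfalso; apply: X0; exists z.
  by rewrite mulr0 addr0; under eq_bigr do rewrite dist0;
    under [in leRHS]eq_bigr do rewrite dist0.
exists (delta + 1) => [|f]; first by rewrite addr_ge0.
(* One error [e] per index adds up to 1, which [delta + 1] absorbs. *)
pose e : R := #|sgn_index n|%:R^-1.
have e0 : 0 < e.
  by rewrite invr_gt0 ltr0n; apply/card_gt0P; exists (ord0, true).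
have near_pair (k : 'I_n.+1) : exists p : X * X,
    hull_dist (f (k, true)) (f (k, false)) <
    mdist p.1 p.2 - f (k, true) p.1 - f (k, false) p.2 + e.
  have [y [z yz]] := hull_dist_attained (f (k, true)) (f (k, false)) x0 e0.
  by exists (y, z).
have [p pP] := choice near_pair.
pose x (i : sgn_index n) := if i.2 then (p i.1).1 else (p i.1).2.
have [alpha alphaN le_alpha] := hyp x; exists alpha => //.
have ub i : mdist (f i) (f (sgn_opp i)) <=
    mdist (x i) (x (sgn_opp i)) - f i (x i) - f (sgn_opp i) (x (sgn_opp i)) + e.
  case: i => k []; have := pP k; rewrite -hull_distE /sgn_opp /x/=; first exact: ltW.
  rewrite (metric_sym (f (k, true))) (metric_sym (p k).1); lra.
(* Evaluate the difference at [x (alpha i)] and bound [f i] from below there by domination. *)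
have lb i : mdist (x i) (x (alpha i)) - f i (x i) - f (alpha i) (x (alpha i)) <=
    mdist (f i) (f (alpha i)).
  rewrite (le_trans _ (hull_dist_ge _ _ (x (alpha i))))//.
  have [df _] := hull_extremal (f i).
  by rewrite (le_trans _ (ler_norm _))// lerD2r lerBlDl df.
pose S := \sum_i f i (x i).
have So : \sum_i f (sgn_opp i) (x (sgn_opp i)) = S.
  by rewrite /S [RHS](reindex_inj (@sgn_opp_inj n)).
have Sa : \sum_i f (alpha i) (x (alpha i)) = S.
  by rewrite /S [RHS](reindex_inj (@perm_inj _ alpha)).
have {}ub := ler_sum (index_enum _) (fun i (_ : true) => ub i).
have {}lb := ler_sum (index_enum _) (fun i (_ : true) => lb i).
move: ub lb; rewrite !big_split/= !sumrN So Sa sumr_const -/S.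
rewrite [e *+ _](_ : _ = 1) ?/e; last first.
  by rewrite -[LHS]mulr_natr mulVf// gt_eqF// -invr_gt0.
by lra.
Qed.

End hyperbolicity_hull.

(** * Retraction onto the hull *)

Lemma le_infD (R : realType) (A B : set R) (c : R) : A !=set0 -> B !=set0 ->
  (forall a b, A a -> B b -> c <= a + b) -> c <= inf A + inf B.
Proof.
move=> A0 B0 cAB; rewrite -lerBlDr; apply: lb_le_inf => // a Aa.
rewrite lerBlDr -lerBlDl; apply: lb_le_inf => // b Bb.
by rewrite lerBlDl; exact: cAB.
Qed.

Lemma ge_inf_lb (R : realType) (A : set R) (a c : R) :
  (forall b, A b -> c <= b) -> A a -> inf A <= a.
Proof. by move=> cA Aa; apply: ge_inf => //; exists c => b /cA. Qed.

Section hull_retraction.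
Context {R : realType} {X : metricType R}.
Implicit Types f g : X -> R.

(** A dominating [f] satisfies [conj_fun f <= f]; the gap measures how far [f] is from being
    extremal. *)
Definition conj_fun f x : R := sup [set mdist x y - f y | y in [set: X]].

(** The conjugate itself may fail to dominate the distance; its average with [f] still dominates it
    and at least halves the gap. *)
Definition avg_conj f x : R := (f x + conj_fun f x) / 2.

Definition retract_fun f x : R := inf (range (fun k => iter k avg_conj f x)).

Lemma conj_fun_le f x : dominates_dist f -> conj_fun f x <= f x.
Proof.
move=> df; apply: ge_sup; first by exists (mdist x x - f x), x.
by move=> _ [y _ <-]; rewrite lerBlDr.
Qed.

Lemma conj_fun_ge f x y : dominates_dist f -> mdist x y - f y <= conj_fun f x.
Proof.
move=> df; apply: ub_le_sup; last by exists y.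
by exists (f x) => _ [z _ <-]; rewrite lerBlDr.
Qed.

Lemma avg_conj_le f x : dominates_dist f -> avg_conj f x <= f x.
Proof. by move=> /conj_fun_le - /(_ x); rewrite /avg_conj; lra. Qed.

Lemma dominates_avg_conj f : dominates_dist f -> dominates_dist (avg_conj f).
Proof.
move=> df x y; have := conj_fun_ge x y df; have := conj_fun_ge y x df.
by rewrite /avg_conj (metric_sym y x); lra.
Qed.

(** Conjugation reverses the order, so [avg_conj f <= f] can only raise the conjugate, while half of
    the gap has been removed from [f]. *)
Lemma avg_conj_gap f x : dominates_dist f ->
  avg_conj f x - conj_fun (avg_conj f) x <= (f x - conj_fun f x) / 2.
Proof.
move=> df; suff : conj_fun f x <= conj_fun (avg_conj f) x.
  by rewrite /avg_conj; lra.
apply: ge_sup; first by exists (mdist x x - f x), x.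
move=> _ [y _ <-]; apply: le_trans (conj_fun_ge x y (dominates_avg_conj df)).
by rewrite lerD2l lerN2 avg_conj_le.
Qed.

Lemma conj_fun_close f g x (c : R) : dominates_dist g ->
  (forall y, `|f y - g y| <= c) -> conj_fun f x <= conj_fun g x + c.
Proof.
move=> dg fg; apply: ge_sup; first by exists (mdist x x - f x), x.
move=> _ [y _ <-]; have := conj_fun_ge x y dg.
by have := fg y; rewrite ler_norml; lra.
Qed.

Lemma avg_conj_close f g (c : R) : dominates_dist f -> dominates_dist g ->
  (forall x, `|f x - g x| <= c) -> forall x, `|avg_conj f x - avg_conj g x| <= c.
Proof.
move=> df dg fg x; have gf y : `|g y - f y| <= c by rewrite distrC.
have := conj_fun_close x dg fg; have := conj_fun_close x df gf.
by have := fg x; rewrite /avg_conj !ler_norml; lra.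
Qed.

Section iterates.
Variables (f : X -> R) (df : dominates_dist f).
Let q k := iter k avg_conj f.

Lemma dominates_iter k : dominates_dist (q k).
Proof. by elim: k => //= k; exact: dominates_avg_conj. Qed.

Lemma iter_avg_conj_le k l x : (k <= l)%N -> q l x <= q k x.
Proof.
move=> /subnK <-; elim: (l - k)%N => //= j; apply: le_trans.
exact/avg_conj_le/dominates_iter.
Qed.

Lemma iter_avg_conj_gap k x :
  q k x - conj_fun (q k) x <= (f x - conj_fun f x) / 2 ^+ k.
Proof.
elim: k => [|k ih]; first by rewrite expr0 divr1.
rewrite (le_trans (avg_conj_gap x (dominates_iter k)))//.
by rewrite exprSr invfM mulrA ler_pM2r.
Qed.

Lemma retract_fun_le k x : retract_fun f x <= q k x.
Proof.
apply: (@ge_inf_lb _ _ _ 0); last by exists k.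
by move=> _ [l _ <-]; exact/dominates_dist_ge0/dominates_iter.
Qed.

Lemma dominates_retract : dominates_dist (retract_fun f).
Proof.
move=> x y; apply: le_infD.
- by exists (f x), 0%N.
- by exists (f y), 0%N.
move=> _ _ [k _ <-] [l _ <-].
have le_k := iter_avg_conj_le x (leq_maxl k l).
have le_l := iter_avg_conj_le y (leq_maxr k l).
exact: le_trans (dominates_iter (maxn k l) x y) (lerD le_k le_l).
Qed.

(** For large [k] the gap of [q k] is small, so a near maximizer [y] in its conjugate makes [q k]
    nearly tight at [x]; the retract lies below [q k] at both points. *)
Lemma extremal_retract : extremal (retract_fun f).
Proof.
apply: tight_extremal => [|x e e0]; first exact: dominates_retract.
pose gap := f x - conj_fun f x.
have gap0 : 0 <= gap by rewrite subr_ge0 conj_fun_le.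
have e2 : 0 < e / 2 by rewrite divr_gt0.
have [k gapk] : exists k, gap / 2 ^+ k < e / 2.
  (* The Archimedean bound suffices because [k < 2 ^ k]. *)
  exists (Num.bound (gap / (e / 2))).
  rewrite ltr_pdivrMr ?exprn_gt0// -ltr_pdivrMl// mulrC.
  have := archi_boundP (divr_ge0 gap0 (ltW e2)).
  move=> /lt_le_trans; apply; rewrite -natrX ler_nat; exact/ltnW/ltn_expl.
have gk := le_lt_trans (iter_avg_conj_gap k x) gapk.
have S0 : [set mdist x y - q k y | y in [set: X]] !=set0.
  by exists (mdist x x - q k x), x.
have S1 : has_ubound [set mdist x y - q k y | y in [set: X]].
  exists (q k x) => _ [z _ <-]; rewrite lerBlDr; exact: dominates_iter.
have [_ [y _ <-] ylt] := sup_adherent e2 (conj S0 S1).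
rewrite -/(conj_fun (q k) x) in ylt.
exists y; have := retract_fun_le k x; have := retract_fun_le k y.
by lra.
Qed.

End iterates.

(** Conjugation and averaging are 1-Lipschitz for the supremum distance, hence so are all iterates
    and their infimum. *)
Lemma retract_fun_close f g (c : R) : dominates_dist f -> dominates_dist g ->
  (forall x, `|f x - g x| <= c) ->
  forall x, `|retract_fun f x - retract_fun g x| <= c.
Proof.
have half f' g' x : dominates_dist f' -> dominates_dist g' ->
    (forall x, `|f' x - g' x| <= c) -> retract_fun f' x <= retract_fun g' x + c.
  move=> df dg fg; rewrite -lerBlDr; apply: lb_le_inf; first by exists (g' x), 0%N.
  move=> _ [k _ <-]; rewrite lerBlDr (le_trans (retract_fun_le df k x))//.
  suff : `|iter k avg_conj f' x - iter k avg_conj g' x| <= c.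
    by rewrite ler_norml; lra.
  elim: k x => [|k ih] x; first exact: fg.
  by apply: avg_conj_close => //; exact: dominates_iter.
move=> df dg fg x; have gf y : `|g y - f y| <= c by rewrite distrC.
by rewrite ler_norml; have := half _ _ x df dg fg; have := half _ _ x dg df gf; lra.
Qed.

End hull_retraction.

Lemma coord_le_norm (R : realType) m (u : 'rV[R]_m) i : `|u 0 i| <= `|u|.
Proof.
rewrite [leRHS]/Num.norm/= mx_normrE.
exact: (le_bigmax _ (fun ij : 'I_1 * 'I_m => `|u ij.1 ij.2|) (0, i)).
Qed.

Lemma rV_norm_le (R : realType) m (u : 'rV[R]_m) (c : R) :
  0 <= c -> (forall i, `|u 0 i| <= c) -> `|u| <= c.
Proof.
move=> c0 uc; rewrite /Num.norm/= mx_normrE.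
by apply: bigmax_le => // -[i j] _ /=; rewrite ord1.
Qed.

(** * A cube in the hull from a potential with slack *)

Section hull_contains_cube.
Context {R : realType} {X : metricType R} (n : nat).
Variables (x : sgn_index n -> X) (f0 : sgn_index n -> R) (sigma : R).
Hypothesis sigma0 : 0 <= sigma.
Hypothesis f0_pair :
  forall i, f0 i + f0 (sgn_opp i) = mdist (x i) (x (sgn_opp i)).
Hypothesis f0_slack : forall i j, j <> sgn_opp i ->
  mdist (x i) (x j) + sigma <= f0 i + f0 j.

Let cube (u : 'rV[R]_n.+1) := forall i, - (sigma / 2) <= u 0 i <= sigma / 2.
(** The embedding has to be a total map, so points outside the cube are sent to its centre. *)
Let clamp u := if `[< cube u >] then u else 0.

Let cube_clamp u : cube (clamp u).
Proof.
rewrite /clamp; case: asboolP => // _ i.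
by rewrite mxE oppr_le0 andbb divr_ge0.
Qed.

Let F (u : 'rV[R]_n.+1) (i : sgn_index n) :=
  f0 i + (if i.2 then u 0 i.1 else - u 0 i.1).

Let F_pair u i : F u i + F u (sgn_opp i) = mdist (x i) (x (sgn_opp i)).
Proof. by rewrite -f0_pair /F; case: i => k []/=; lra. Qed.

(** For [j <> - i] the two values drop by at most [sigma / 2] each, which the slack covers; for
    [j = - i] the changes cancel. *)
Let F_dom u i j : cube u -> mdist (x i) (x j) <= F u i + F u j.
Proof.
move=> cu; have [->|/eqP/f0_slack] := eqVneq j (sgn_opp i); first by rewrite F_pair.
have := cu i.1; have := cu j.1.
by rewrite /F; case: i.2; case: j.2; lra.
Qed.

(** The McShane extension of [F u] from the points [x i] to [X]. *)
Let ext u (y : X) := inf (range (fun i => F u i + mdist y (x i))).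

Let ext_mem u i y : range (fun i => F u i + mdist y (x i)) (F u i + mdist y (x i)).
Proof. by exists i. Qed.

Let ext_le u i y : cube u -> ext u y <= F u i + mdist y (x i).
Proof.
move=> cu; apply: (@ge_inf_lb _ _ _ 0); last exact: ext_mem.
move=> _ [j _ <-]; rewrite addr_ge0 ?mdist_ge0//.
by have := F_dom j j cu; rewrite mdistxx; lra.
Qed.

Let ext_dom u : cube u -> dominates_dist (ext u).
Proof.
move=> cu y z; apply: le_infD; [by eexists; exact: (@ext_mem _ (ord0, true))..|].
move=> _ _ [i _ <-] [j _ <-]; have := F_dom i j cu.
have := metric_triangle y (x i) z; have := metric_triangle (x i) (x j) z.
by rewrite (metric_sym (x j) z); lra.
Qed.

Let ext_close u v y : cube u -> cube v -> ext u y <= ext v y + `|u - v|.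
Proof.
move=> cu cv; rewrite -lerBlDr; apply: lb_le_inf.
  by eexists; exact: (@ext_mem _ (ord0, true)).
move=> _ [i _ <-]; rewrite lerBlDr (le_trans (ext_le i y cu))//.
rewrite [leRHS]addrAC lerD2r /F -addrA lerD2l; have := coord_le_norm (u - v) i.1.
by rewrite !mxE ler_norml; case: i.2; lra.
Qed.

(** The retract is at most [F u] at [x i] and at [x (- i)], and its two values there sum to at least
    the distance, which is the sum of the two values of [F u]. *)
Let retract_ext u i : cube u -> retract_fun (ext u) (x i) = F u i.
Proof.
move=> cu; have le_F j : retract_fun (ext u) (x j) <= F u j.
  rewrite (le_trans (retract_fun_le (ext_dom cu) 0 (x j)))//.
  by rewrite (le_trans (ext_le j _ cu))// mdistxx addr0.
apply/le_anti; rewrite le_F/=; have := le_F (sgn_opp i); have := F_pair u i.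
have := dominates_retract (ext_dom cu) (x i) (x (sgn_opp i)); lra.
Qed.

(** Extension and retraction do not increase distances, which gives the upper bound. For the lower
    bound, evaluation at [x (k, true)] recovers the coordinate [k] of [u - v]. *)
Lemma contains_linfty_ball_hull :
  contains_linfty_ball n.+1 (sigma / 2) (injective_hull X).
Proof.
exists (fun u => InjectiveHull (extremal_retract (ext_dom (cube_clamp u)))).
move=> u v cu cv; have clampK w : cube w -> clamp w = w.
  by rewrite /clamp; case: asboolP.
apply/le_anti/andP; split.
  apply: hull_dist_le => // y /=; rewrite !clampK//.
  apply: retract_fun_close; [exact: ext_dom..|move=> z].
  have := ext_close z cu cv; have := ext_close z cv cu.
  by rewrite ler_norml (distrC v u); lra.
apply: rV_norm_le => [|k]; first exact: mdist_ge0.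
rewrite (le_trans _ (hull_dist_ge _ _ (x (k, true))))//= !clampK// !retract_ext//.
by rewrite /F /= !mxE opprD addrACA subrr add0r.
Qed.

End hull_contains_cube.

(** * Duality for the assignment problem *)

Section walk_potential.
Context {R : realType} {T : finType} (c : T -> T -> R).

Fixpoint walk_weight (x : T) (s : seq T) : R :=
  if s is y :: s' then c x y + walk_weight y s' else 0.

Lemma walk_weight_cat x s1 y s2 :
  walk_weight x (s1 ++ y :: s2) = walk_weight x (rcons s1 y) + walk_weight y s2.
Proof. by elim: s1 x => [|z s1 ih] x /=; rewrite ?ih ?addr0 ?addrA. Qed.

(** The return point [y0] is kept apart from the first point [y] for the induction; with [y0 = y]
    the sum runs over the edges of a cycle. *)
Lemma walk_weight_next_at y0 y p : uniq (y :: p) ->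
  walk_weight y (rcons p y0) = \sum_(z <- y :: p) c z (next_at z y0 y p).
Proof.
elim: p y => [|y' p ih] y; first by rewrite /= big_seq1 eqxx addr0.
move=> /andP[yp up]; rewrite big_cons /= eqxx ih//; congr (_ + _).
by apply: eq_big_seq => z zp; case: eqP => // zy; rewrite -zy zp in yp.
Qed.

Lemma not_uniq_split (s : seq T) : ~~ uniq s ->
  exists y s1 s2 s3, s = s1 ++ y :: s2 ++ y :: s3.
Proof.
elim: s => //= a s ih; rewrite negb_and negbK => /orP[/splitPr[s2 s3]|/ih].
  by exists a, [::], s2, s3.
by move=> [y [s1 [s2 [s3 ->]]]]; exists y, (a :: s1), s2, s3.
Qed.

Hypothesis uniq_cycle_le0 :
  forall s : seq T, uniq s -> \sum_(z <- s) c z (next s z) <= 0.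

(** A closed walk that repeats a vertex splits there into two shorter closed walks; without
    repetition it is a simple cycle. *)
Lemma closed_walk_le0 x s : walk_weight x (rcons s x) <= 0.
Proof.
have [m] := ubnP (size s); elim: m x s => // m ih x s sm.
have [us|] := boolP (uniq (x :: s)).
  by rewrite walk_weight_next_at//; exact: uniq_cycle_le0.
move=> /not_uniq_split[y [s1 [s2 [s3]]]].
(* Either the base point itself is repeated, or a loop at an inner vertex [y] is cut out. *)
case: s1 => [|a s1] [ex es]; move: sm; rewrite ex es ?size_cat/= ?size_cat/= => sm.
  rewrite rcons_cat/= walk_weight_cat.
  by rewrite -[leRHS]addr0 lerD// ih//; lia.
rewrite rcons_cat/= rcons_cat/= walk_weight_cat walk_weight_cat addrCA.
rewrite -walk_weight_cat -rcons_cons -rcons_cat.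
by rewrite -[leRHS]addr0 lerD// ih// ?size_cat/=; lia.
Qed.

(** The potential at [y] is the supremum of the weights of walks from a base point to [y]; it is
    finite because the edge back to the base point closes each of them. *)
Lemma walk_potential : exists u : T -> R, forall x y, c x y <= u y - u x.
Proof.
have [[x0]|T0] := pselect (inhabited T); last first.
  by exists (fun=> 0) => x; exfalso; apply: T0.
pose W y := [set walk_weight x0 (rcons s y) | s in [set: seq T]].
have Wub y : has_ubound (W y).
  exists (- c y x0) => _ [s _ <-].
  have := closed_walk_le0 x0 (rcons s y).
  by rewrite -cats1 -cats1 -catA/= walk_weight_cat/= cats1; lra.
exists (fun y => sup (W y)) => x y; rewrite lerBrDr -lerBrDl.
apply: ge_sup; first by exists (walk_weight x0 (rcons [::] x)), [::].
move=> _ [s _ <-]; rewrite lerBrDl; apply: ub_le_sup => //.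
exists (rcons s x) => //.
by rewrite -(cats1 (rcons s x)) -(cats1 s x) -catA/= walk_weight_cat/= cats1; lra.
Qed.

End walk_potential.

Section dual_potential.
Context {R : realType} {X : metricType R} (n : nat).
Variables (x : sgn_index n -> X) (delta : R).
Hypothesis delta0 : 0 <= delta.
Hypothesis gap : forall alpha : {perm sgn_index n},
  alpha <> perm (@sgn_opp_inj n) ->
  \sum_i mdist (x i) (x (alpha i)) + 2 * delta < \sum_i mdist (x i) (x (sgn_opp i)).

Let sigma := delta / n.+1%:R.
(** The gain when the partner [- k] is handed over from [k] to [i], plus [sigma] for a real change.
    There are [2 * n.+1] indices, so these additions total at most [2 * delta]. *)
Let c (k i : sgn_index n) : R := mdist (x i) (x (sgn_opp k)) -
  mdist (x k) (x (sgn_opp k)) + (if i == k then 0 else sigma).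

Let ckk k : c k k = 0. Proof. by rewrite /c subrr eqxx addr0. Qed.

Let sigma0 : 0 <= sigma. Proof. by rewrite divr_ge0. Qed.

Let perm_le0 (beta : {perm sgn_index n}) : \sum_k c k (beta k) <= 0.
Proof.
have [->|beta1] := eqVneq beta 1%g.
  by rewrite big1// => k _; rewrite perm1 ckk.
(* This permutation sends [beta k] to [- k]. *)
pose alpha := (beta^-1 * perm (@sgn_opp_inj n))%g.
have alphaN : alpha <> perm (@sgn_opp_inj n).
  move=> /(congr1 (fun s => s * (perm (@sgn_opp_inj n))^-1)%g).
  by rewrite /alpha mulgK mulgV => /eqP; rewrite invg_eq1 (negbTE beta1).
have /ltW := gap alphaN; rewrite (reindex_inj (@perm_inj _ beta))/=.
have -> : \sum_k mdist (x (beta k)) (x (alpha (beta k))) =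
    \sum_k mdist (x (beta k)) (x (sgn_opp k)).
  by apply: eq_bigr => k _; rewrite permM permK permE.
rewrite /c big_split/= sumrB.
suff : \sum_k (if beta k == k then 0 else sigma) <= 2 * delta by lra.
rewrite (@le_trans _ _ (\sum_(k : sgn_index n) sigma))//.
  by apply: ler_sum => k _; case: ifP.
rewrite sum_sgn_index sumr_const card_ord -[leLHS]mulr_natr /sigma.
by rewrite -mulrDl divfK// mulr2n mulrDl mul1r.
Qed.

(** With [v i = d (x i) (x (- i)) - u (- i)], the potential inequality for [c] reads
    [u i + v j >= d (x i) (x j) + sigma]. Averaging it with [i] and [j] exchanged merges [u] and [v]
    into the single function [f = (u + v) / 2]. *)
Lemma dual_potential : exists f : sgn_index n -> R,
  (forall i, f i + f (sgn_opp i) = mdist (x i) (x (sgn_opp i))) /\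
  (forall i j, j <> sgn_opp i -> mdist (x i) (x j) + sigma <= f i + f j).
Proof.
have [s us|u cu] := @walk_potential R _ c.
  (* A simple cycle [s] gives the permutation [next s], which fixes all indices outside [s], where
     [c k k = 0]. *)
  rewrite (le_trans _ (perm_le0 (perm (can_inj (prev_next us)))))//.
  rewrite [leRHS](bigID (mem s))/= [X in _ <= _ + X]big1 => [|k ks]; last first.
    by rewrite permE next_nth (negbTE ks) ckk.
  rewrite addr0 big_uniq//.
  by apply: ler_sum => k _; rewrite permE.
exists (fun i => (u i + (mdist (x (sgn_opp i)) (x i) - u (sgn_opp i))) / 2).
split=> [i|i j ji].
  by rewrite sgn_oppK (metric_sym (x (sgn_opp i))); lra.
have ij : i <> sgn_opp j by move=> ij; apply: ji; rewrite ij sgn_oppK.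
have := cu (sgn_opp i) j; have := cu (sgn_opp j) i.
rewrite /c !sgn_oppK; case: eqP => // _; case: eqP => // _.
by rewrite (metric_sym (x j) (x i)); lra.
Qed.

End dual_potential.

Lemma star_hyperbolic_of_no_cube (R : realType) (X : metricType R) n :
  (exists r0 : R, forall r, r0 < r ->
     ~ contains_linfty_ball n.+1 r (injective_hull X)) -> star_hyperbolic n X.
Proof.
move=> [r0 no_cube]; pose r := Num.max r0 0 + 1.
have r_gt : r0 < r by rewrite ltr_pwDr// le_max lexx.
have r_ge0 : 0 <= r by rewrite addr_ge0// le_max lexx orbT.
(* Chosen so that the slack [delta / n.+1] is [2 * r] and the cube has radius [r]. *)
pose delta := r * 2 * n.+1%:R.
have delta0 : 0 <= delta by rewrite !mulr_ge0.
exists delta => // x; apply: contrapT => hypN; apply: (no_cube r r_gt).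
have gap (alpha : {perm sgn_index n}) : alpha <> perm (@sgn_opp_inj n) ->
    \sum_i mdist (x i) (x (alpha i)) + 2 * delta <
    \sum_i mdist (x i) (x (sgn_opp i)).
  by move=> alphaN; rewrite ltNge; apply/negP => ?; apply: hypN; exists alpha.
have [f [f_pair f_slack]] := dual_potential delta0 gap.
rewrite /delta mulfK// in f_slack.
have -> : r = r * 2 / 2 by rewrite mulfK.
by apply: (contains_linfty_ball_hull _ f_pair f_slack); rewrite mulr_ge0.
Qed.

(** * Ultralimits of hyperbolic metrics *)

(** An ultrafilter finer than [\oo] makes all bounded sequences converge at once, in place of
    repeated passage to subsequences. *)
Lemma ultrafilter_limits (R : realType) : exists F : set_system nat,
  [/\ ProperFilter F, \oo `<=` F & forall (u : nat -> R) (B : R),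
    (\forall k \near \oo, `|u k| <= B) -> cvg (u k @[k --> F])].
Proof.
have [F [FU ooF]] := ultraFilterLemma (eventually_filter : ProperFilter \oo).
exists F; split=> [||u B uB]; [exact: ultra_proper|exact: ooF|].
have FB : (u @ F) `[- B, B]%classic.
  apply: (@filterS _ F _ [set k | `|u k| <= B]); last exact: ooF uB.
  by move=> k /=; rewrite in_itv/= ler_norml.
have [l [_ lcluster]] := @segment_compact _ (- B) B _ _ FB.
apply/cvg_ex; exists l; apply/cvgrPdist_lt => e e0.
have [//|Fe] := in_ultra_setVsetC [set k | `|l - u k| < e] FU.
have [y [/= ye]] := lcluster [set y | ~ `|l - y| < e] (ball l e) Fe (nbhsx_ballx _ _ e0).
by [].
Qed.

Section permutation_gap.
Context {R : realType} (n : nat).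
Implicit Type D : sgn_index n -> sgn_index n -> R.

(** The [(n, 0)]-hyperbolicity inequality, stated for a bare matrix so that it can pass to limits of
    metrics. *)
Definition pairing_beaten D := exists2 alpha : {perm sgn_index n},
  alpha <> perm (@sgn_opp_inj n) &
  \sum_i D i (sgn_opp i) <= \sum_i D i (alpha i).

(** There are finitely many permutations, so the one with the largest sum serves for every [eta]. *)
Lemma pairing_beaten_approx D :
  (forall eta : R, 0 < eta -> exists2 alpha : {perm sgn_index n},
    alpha <> perm (@sgn_opp_inj n) &
    \sum_i D i (sgn_opp i) <= \sum_i D i (alpha i) + eta) ->
  pairing_beaten D.
Proof.
move=> approx.
have one_neq : (1%g : {perm sgn_index n}) != perm (@sgn_opp_inj n).
  by apply/eqP; exact: one_neq_sgn_opp.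
case: (@arg_maxP _ _ _ (1%g : {perm sgn_index n})
  (fun alpha => alpha != perm (@sgn_opp_inj n))
  (fun alpha => \sum_i D i (alpha i)) one_neq) => alpha0 /eqP alpha0N max0.
exists alpha0 => //; apply/ler_addgt0Pr => eta /approx[alpha /eqP alphaN le_alpha].
by rewrite (le_trans le_alpha)// lerD2r; exact: max0.
Qed.

Lemma pairing_beaten_lim (F : set_system nat) (Dk : nat -> _) D :
  ProperFilter F -> (forall i j, Dk k i j @[k --> F] --> D i j) ->
  (\forall k \near F, pairing_beaten (Dk k)) -> pairing_beaten D.
Proof.
move=> FF DkD hypk; apply: pairing_beaten_approx => eta eta0.
pose N : R := #|sgn_index n|%:R.
have N0 : 0 < N by rewrite ltr0n; apply/card_gt0P; exists (ord0, true).
(* Each of the two sums has [N] entries and may thus change by [eta / 2]. *)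
have e0 : 0 < eta / N / 2 by rewrite !divr_gt0.
have close : \forall k \near F, forall ij : sgn_index n * sgn_index n,
    `|D ij.1 ij.2 - Dk k ij.1 ij.2| < eta / N / 2.
  apply: filter_forall => -[i j].
  by have /cvgrPdist_lt/(_ _ e0) := DkD i j.
have [k [{}close [alpha alphaN le_alpha]]] := filter_ex (filterI close hypk).
exists alpha => //.
have sumN (e : R) : \sum_(i : sgn_index n) e = e * N.
  by rewrite sumr_const -[LHS]mulr_natr.
have le1 : \sum_i D i (sgn_opp i) <= \sum_i (Dk k i (sgn_opp i) + eta / N / 2).
  by apply: ler_sum => i _; have := close (i, sgn_opp i); rewrite ltr_norml/=; lra.
have le2 : \sum_i Dk k i (alpha i) <= \sum_i (D i (alpha i) + eta / N / 2).
  by apply: ler_sum => i _; have := close (i, alpha i); rewrite ltr_norml/=; lra.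
rewrite big_split/= in le1; rewrite big_split/= in le2.
have : eta / N / 2 * N = eta / 2 by rewrite mulrAC divfK ?gt_eqF.
by rewrite !sumN in le1 le2; lra.
Qed.

End permutation_gap.

(** * Euclidean inner product and norm *)

Section dot_product.
Context {R : realType} (m : nat).
Implicit Types u v w : 'rV[R]_m.

Definition dot u v : R := \sum_i u 0 i * v 0 i.

Lemma dotC u v : dot u v = dot v u.
Proof. by apply: eq_bigr => i _; rewrite mulrC. Qed.

Lemma dotDl u v w : dot (u + v) w = dot u w + dot v w.
Proof. by rewrite -big_split; apply: eq_bigr => i _; rewrite mxE mulrDl. Qed.

Lemma dotZl (a : R) u v : dot (a *: u) v = a * dot u v.
Proof. by rewrite mulr_sumr; apply: eq_bigr => i _; rewrite mxE mulrA. Qed.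

Lemma dotDr u v w : dot w (u + v) = dot w u + dot w v.
Proof. by rewrite dotC dotDl !(dotC w). Qed.

Lemma dotZr (a : R) u v : dot u (a *: v) = a * dot u v.
Proof. by rewrite dotC dotZl dotC. Qed.

Lemma dotNl u v : dot (- u) v = - dot u v.
Proof. by rewrite -scaleN1r dotZl mulN1r. Qed.

Lemma dotNr u v : dot u (- v) = - dot u v.
Proof. by rewrite dotC dotNl dotC. Qed.

Definition dotE := (dotDl, dotDr, dotZl, dotZr, dotNl, dotNr).

Lemma dot_ge0 u : 0 <= dot u u.
Proof. by apply: sumr_ge0 => i _; rewrite -expr2 sqr_ge0. Qed.

Lemma dot_eq0 u : (dot u u == 0) = (u == 0).
Proof.
apply/eqP/eqP => [u0|->]; last by rewrite /dot big1// => i _; rewrite mxE mul0r.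
apply/rowP => i; rewrite mxE.
have sq_ge0 k : true -> 0 <= u 0 k * u 0 k by rewrite -expr2 sqr_ge0.
by have /(_ i isT)/eqP := psumr_eq0P sq_ge0 u0; rewrite mulf_eq0 orbb => /eqP.
Qed.

Lemma coord_le_dot u i : u 0 i ^+ 2 <= dot u u.
Proof.
rewrite /dot (bigD1 i)//= -expr2 lerDl; apply: sumr_ge0 => k _.
by rewrite -expr2 sqr_ge0.
Qed.

Lemma euclidean_normE u : euclidean_norm u = Num.sqrt (dot u u).
Proof. by congr Num.sqrt; apply: eq_bigr => i _; rewrite expr2. Qed.

Lemma sqr_euclidean_norm u : euclidean_norm u ^+ 2 = dot u u.
Proof. by rewrite euclidean_normE sqr_sqrtr// dot_ge0. Qed.

Lemma euclidean_norm_ge0 u : 0 <= euclidean_norm u.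
Proof. exact: sqrtr_ge0. Qed.

Lemma euclidean_norm_unit u : dot u u = 1 -> euclidean_norm u = 1.
Proof. by move=> u1; rewrite euclidean_normE u1 sqrtr1. Qed.

Lemma euclidean_normZ (a : R) u : euclidean_norm (a *: u) = `|a| * euclidean_norm u.
Proof.
by rewrite !euclidean_normE !dotE mulrA -expr2 sqrtrM ?sqr_ge0// sqrtr_sqr.
Qed.

Lemma euclidean_normN u : euclidean_norm (- u) = euclidean_norm u.
Proof. by rewrite -scaleN1r euclidean_normZ normrN1 mul1r. Qed.

Lemma euclidean_norm0 : euclidean_norm (0 : 'rV[R]_m) = 0.
Proof. by rewrite -(scale0r 0) euclidean_normZ normr0 mul0r. Qed.

Lemma euclidean_norm_gt0 u : u != 0 -> 0 < euclidean_norm u.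
Proof.
move=> u0; rewrite euclidean_normE sqrtr_gt0 lt_neqAle dot_ge0 eq_sym.
by rewrite dot_eq0 u0.
Qed.

(** This is the square of [a - |u|] being nonnegative; it removes the square root at a second-order
    cost when [|u|] is close to [a]. *)
Lemma euclidean_norm_le (a : R) u : 0 < a ->
  euclidean_norm u <= (a ^+ 2 + dot u u) / (2 * a).
Proof.
move=> a0; rewrite ler_pdivlMr ?mulr_gt0// -sqr_euclidean_norm.
by have := sqr_ge0 (a - euclidean_norm u); rewrite sqrrB; lra.
Qed.

Lemma cvg_dot (F : set_system nat) (uk vk : nat -> 'rV[R]_m) u v : Filter F ->
  (forall i, uk k 0 i @[k --> F] --> u 0 i) ->
  (forall i, vk k 0 i @[k --> F] --> v 0 i) ->
  dot (uk k) (vk k) @[k --> F] --> dot u v.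
Proof.
move=> FF uku vkv; apply: cvg_big => [|i _]; first by move=> x; exact: add_continuous.
by apply: cvgM; [exact: uku|exact: vkv].
Qed.

Lemma cvg_euclidean_norm (F : set_system nat) (uk : nat -> 'rV[R]_m) u : Filter F ->
  (forall i, uk k 0 i @[k --> F] --> u 0 i) ->
  euclidean_norm (uk k) @[k --> F] --> euclidean_norm u.
Proof.
move=> FF uku; rewrite euclidean_normE.
under eq_fun do rewrite euclidean_normE.
apply: (@cvg_comp _ _ _ (fun k => dot (uk k) (uk k)) Num.sqrt F _ _).
  exact: cvg_dot.
exact: sqrt_continuous.
Qed.

Lemma exists_orthogonal (e : nat -> 'rV[R]_m) j : (j < m)%N ->
  exists2 v : 'rV[R]_m, v != 0 & forall i, (i < j)%N -> dot v (e i) = 0.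
Proof.
move=> jm; pose A : 'M[R]_(m, j) := \matrix_(k, i) e i 0 k.
have : kermx A != 0.
  rewrite -mxrank_eq0 mxrank_ker -lt0n subn_gt0.
  exact: leq_ltn_trans (rank_leq_col A) jm.
move=> /rowV0Pn[v /sub_kermxP vA v0]; exists v => // i ij.
move/matrixP/(_ 0 (Ordinal ij)) : vA; rewrite !mxE => <-.
by apply: eq_bigr => k _; rewrite mxE.
Qed.

End dot_product.

(** * Flags of geodesic directions *)

Section flags.
Context {R : realType} (m n : nat) (L : R).
Hypothesis L0 : 0 < L.
Local Notation V := 'rV[R]_m.
Implicit Types (d : V -> V -> R) (e : nat -> V) (c : nat -> R).

Definition hyperbolic_bilip d := [/\ forall x y, d x y = d y x,
  forall x y z, d x z <= d x y + d y z,
  forall x y, L^-1 * euclidean_norm (x - y) <= d x y <= L * euclidean_norm (x - y) &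
  forall x : sgn_index n -> V, pairing_beaten (fun i j => d (x i) (x j))].

Definition orth e j (q : V) := forall i, (i < j)%N -> dot q (e i) = 0.

(** When [e j] is a unit vector, the two bounds agree for [q - q'] parallel to it, so [d] is [cj]
    times the Euclidean distance in that direction. *)
Definition slab_bounds e j (cj : R) d := forall q q', orth e j q -> orth e j q' ->
  cj * `|dot (q - q') (e j)| <= d q q' <= cj * euclidean_norm (q - q').

Definition flag_bounds e c j d := forall i, (i < j)%N -> slab_bounds e i (c i) d.

Lemma orthD e j p q (a : R) : orth e j p -> orth e j q -> orth e j (p + a *: q).
Proof. by move=> op oq i ij; rewrite !dotE op// oq// mulr0 addr0. Qed.

Lemma orthZ e j q (a : R) : orth e j q -> orth e j (a *: q).
Proof. by move=> oq i ij; rewrite !dotE oq// mulr0. Qed.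

Lemma orthN e j q : orth e j q -> orth e j (- q).
Proof. by move=> oq i ij; rewrite !dotE oq// oppr0. Qed.

Lemma orth_leq e i j q : (i <= j)%N -> orth e j q -> orth e i q.
Proof. by move=> ij oq k ki; rewrite oq//; exact: leq_trans ki ij. Qed.

Definition zoom (z : V) (h : R) d (p q : V) : R := d (z + h *: p) (z + h *: q) / h.

Lemma hyperbolic_bilip_zoom z h d : 0 < h ->
  hyperbolic_bilip d -> hyperbolic_bilip (zoom z h d).
Proof.
move=> h0 [dC dD dL dhyp]; split.
- by move=> x y; rewrite /zoom dC.
- by move=> x y t; rewrite /zoom -mulrDl ler_pM2r ?invr_gt0.
- move=> x y; rewrite /zoom ler_pdivlMr// ler_pdivrMr//.
  have := dL (z + h *: x) (z + h *: y).
  rewrite opprD addrACA subrr add0r -scalerBr euclidean_normZ gtr0_norm//.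
  by rewrite (mulrC h) !mulrA.
move=> x; have [alpha alphaN le_alpha] := dhyp (fun i => z + h *: x i).
by exists alpha => //; rewrite -!mulr_suml ler_pM2r ?invr_gt0.
Qed.

Lemma flag_bounds_zoom e c j z h d : 0 < h -> (forall i, (i < j)%N -> orth e i z) ->
  flag_bounds e c j d -> flag_bounds e c j (zoom z h d).
Proof.
move=> h0 oz ed i ij q q' oq oq'; rewrite /zoom ler_pdivlMr// ler_pdivrMr//.
have := ed i ij _ _ (orthD h (oz i ij) oq) (orthD h (oz i ij) oq').
rewrite opprD addrACA subrr add0r -scalerBr euclidean_normZ dotZl normrM.
by rewrite (gtr0_norm h0) !(mulrC h) !mulrA.
Qed.

Lemma hyperbolic_bilip_ge0 d x y : hyperbolic_bilip d -> 0 <= d x y.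
Proof.
move=> [_ _ /(_ x y)/andP[le_d _] _]; apply: le_trans le_d.
by rewrite mulr_ge0 ?euclidean_norm_ge0 ?invr_ge0// ltW.
Qed.

Section flag_step.
Variables (e : nat -> V) (c : nat -> R) (j : nat) (d0 : V -> V -> R).
Hypotheses (jm : (j < m)%N) (d0_hyp : hyperbolic_bilip d0)
  (d0_flag : flag_bounds e c j d0).

Let good d := hyperbolic_bilip d /\ flag_bounds e c j d.
Let unit v := orth e j v /\ dot v v = 1.
(** The metric varies together with the vector, so that blow-ups of a competitor compete as well. *)
Let widths := [set d.2 (- d.1) d.1 | d in [set d | unit d.1 /\ good d.2]].

Let good_zoom z h d : 0 < h -> orth e j z -> good d -> good (zoom z h d).
Proof.
move=> h0 oz [? ?]; split; first exact: hyperbolic_bilip_zoom.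
by apply: flag_bounds_zoom => // i ij; exact: orth_leq (ltnW ij) oz.
Qed.

Let exists_unit : exists v, unit v.
Proof.
have [v v0 ov] := exists_orthogonal e jm.
exists ((euclidean_norm v)^-1 *: v); split; first exact: orthZ.
rewrite !dotE -sqr_euclidean_norm expr2 mulKf ?mulVf// gt_eqF//;
  exact: euclidean_norm_gt0.
Qed.

Let norm_unit v : unit v -> euclidean_norm (- v - v) = 2.
Proof.
move=> [_ /euclidean_norm_unit v1].
by rewrite -opprD euclidean_normN -mulr2n -scaler_nat euclidean_normZ v1 mulr1 ger0_norm.
Qed.

Let widths_nonempty : widths !=set0.
Proof. by have [v v1] := exists_unit; exists (d0 (- v) v), (v, d0). Qed.

Let widths_bounds r : widths r -> L^-1 * 2 <= r <= L * 2.
Proof.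
move=> [[v d] /= [v1 [[_ _ dL _] _]] <-].
by have := dL (- v) v; rewrite norm_unit.
Qed.

(** Halved because antipodal unit vectors have Euclidean distance 2. *)
Let width := sup widths / 2.

Let widths_ub : has_ubound widths.
Proof. by exists (L * 2) => r /widths_bounds/andP[]. Qed.

Let width_gt0 : 0 < width.
Proof.
have [r wr] := widths_nonempty; have /andP[Lr _] := widths_bounds wr.
rewrite divr_gt0//; apply: lt_le_trans (ub_le_sup widths_ub wr).
by apply: lt_le_trans Lr; rewrite mulr_gt0 ?invr_gt0.
Qed.

(** Zooming in on the midpoint [z] of [q] and [q'] by half their distance [h] turns the pair into
    antipodal unit vectors [- v], [v] of another admissible metric. *)
Let width_ub d q q' : good d -> orth e j q -> orth e j q' ->
  d q q' <= width * euclidean_norm (q - q').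
Proof.
move=> gd oq oq'; have [->|qq'] := eqVneq q q'.
  have [[_ _ /(_ q' q')/andP[_]]] := gd.
  by rewrite subrr euclidean_norm0 !mulr0.
pose h := euclidean_norm (q - q') / 2.
have h0 : 0 < h by rewrite divr_gt0// euclidean_norm_gt0 ?subr_eq0.
pose z := 2^-1 *: (q + q'); pose v := (2 * h)^-1 *: (q' - q).
have oz : orth e j z by rewrite /z -(scale1r q'); exact/orthZ/orthD.
have v1 : unit v.
  split; first by rewrite /v -scaleN1r; exact/orthZ/orthD.
  have hN : 2 * h = euclidean_norm (q - q') by rewrite /h mulrC divfK.
  rewrite -sqr_euclidean_norm euclidean_normZ -(opprB q q') euclidean_normN hN.
  have N0 : 0 < euclidean_norm (q - q') by rewrite -hN mulr_gt0.
  by rewrite gtr0_norm ?invr_gt0// mulVf ?expr1n// gt_eqF.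
have : zoom z h d (- v) v <= sup widths.
  by apply: ub_le_sup => //; exists (v, zoom z h d) => //; split;
    [exact: v1|exact: (good_zoom h0 oz gd)].
have hv : h *: v = 2^-1 *: (q' - q).
  by rewrite scalerA invfM mulrCA divff ?mulr1 ?gt_eqF.
have zq : z + h *: - v = q.
  by rewrite scalerN hv; apply/rowP => i; rewrite !mxE; lra.
have zq' : z + h *: v = q'.
  by rewrite hv; apply/rowP => i; rewrite !mxE; lra.
rewrite /zoom zq zq' ler_pdivrMr// => /le_trans; apply.
by rewrite /width /h; lra.
Qed.

(* Rescaling a nearly widest pair of antipodal unit vectors makes the defect
   small compared with the distance of the two points, so that both can be
   used as points at infinity. *)
Let wide k : exists de : (V -> V -> R) * V, [/\ good de.1, unit de.2 &
  2 * k.+1%:R * width - k.+1%:R^-1 <= de.1 (- (k.+1%:R *: de.2)) (k.+1%:R *: de.2)].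
Proof.
have T0 : 0 < k.+1%:R :> R by [].
(* Enlarging by [k.+1] multiplies this defect to [k.+1%:R^-1]. *)
have e0 : 0 < (k.+1%:R ^+ 2)^-1 :> R by rewrite invr_gt0 exprn_gt0.
have [_ [[v d] /= [v1 gd] <-] dv] := sup_adherent e0 (conj widths_nonempty widths_ub).
exists (zoom 0 k.+1%:R^-1 d, v); split => //=.
  by apply: good_zoom; rewrite ?invr_gt0// => i ij; rewrite -(scale0r 0) dotZl mul0r.
rewrite /zoom scalerN !scalerA mulVf ?gt_eqF// scale1r !add0r invrK.
have := ltW dv; rewrite -(ler_pM2r T0); apply: le_trans.
by rewrite le_eqVlt; apply/orP; left; apply/eqP; rewrite /width; field; exact: lt0r_neq0.
Qed.

Let wide_pair_arith (w T t a b Q Q' n1 n2 x1 x2 x3 x4 x5 : R) :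
  2 * T * w - t <= x1 -> w * n2 <= w * (T + b + Q' / 2 * t) ->
  w * n1 <= w * (T - a + Q / 2 * t) -> x2 <= x3 + x4 -> x1 <= x5 + x2 ->
  x4 <= w * n1 -> x5 <= w * n2 ->
  w * (a - b) - (1 + w * (Q + Q') / 2) * t <= x3.
Proof. by lra. Qed.

(** Follow the chain [- T v], [q'], [q], [T v]. Its ends are almost [2 * T * width] apart, and the
    outer two pieces are at most [width] times their Euclidean lengths, which are [T + dot q' v] and
    [T - dot q v] up to order [1 / T]. *)
Let limit_bounds (de : nat -> (V -> V -> R) * V) (k : nat) q q' :
  good (de k).1 -> unit (de k).2 ->
  2 * k.+1%:R * width - k.+1%:R^-1 <=
    (de k).1 (- (k.+1%:R *: (de k).2)) (k.+1%:R *: (de k).2) ->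
  orth e j q -> orth e j q' ->
  width * dot (q - q') (de k).2 -
    (1 + width * (dot q q + dot q' q') / 2) * k.+1%:R^-1 <= (de k).1 q q'.
Proof.
case: (de k) => d v /= gd [ov v1] le_d oq oq'.
have [[dC dD _ _] _] := gd.
set T : R := k.+1%:R in le_d *; have T0 : 0 < T by rewrite ltr0n.
have oTv : orth e j (T *: v) by exact: orthZ.
have := width_ub gd (orthN oTv) oq'; have := width_ub gd oq oTv.
have := dD (- (T *: v)) q' (T *: v); have := dD q' q (T *: v).
rewrite (dC q' q).
have le1 : euclidean_norm (q - T *: v) <= T - dot q v + dot q q / 2 * T^-1.
  rewrite (le_trans (euclidean_norm_le _ T0))// !dotE v1 (dotC v q).
  by rewrite le_eqVlt; apply/orP; left; apply/eqP; field; exact: lt0r_neq0.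
have le2 : euclidean_norm (- (T *: v) - q') <= T + dot q' v + dot q' q' / 2 * T^-1.
  rewrite (le_trans (euclidean_norm_le _ T0))// !dotE v1 (dotC v q').
  by rewrite le_eqVlt; apply/orP; left; apply/eqP; field; exact: lt0r_neq0.
have := ler_wpM2l (ltW width_gt0) le1; have := ler_wpM2l (ltW width_gt0) le2.
rewrite !dotE; exact: wide_pair_arith le_d.
Qed.

(** The ultralimit of the metrics and vectors of [wide] works: the error of order [1 / T] in the
    lower bound disappears, and all other properties are closed conditions. *)
Lemma flag_step : exists v w d, [/\ 0 < w, orth e j v /\ dot v v = 1,
  hyperbolic_bilip d, flag_bounds e c j d & forall q q',
  orth e j q -> orth e j q' ->
  w * `|dot (q - q') v| <= d q q' <= w * euclidean_norm (q - q')].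
Proof.
have [F [FF ooF Flim]] := ultrafilter_limits R.
have [de deP] := choice wide.
have dlim q q' : cvg ((de k).1 q q' @[k --> F]).
  apply: (Flim _ (L * euclidean_norm (q - q'))); apply: nearW => k.
  have [[dh _] _ _] := deP k; have [_ _ /(_ q q')/andP[_ dL] _] := dh.
  by rewrite ger0_norm// hyperbolic_bilip_ge0.
have vlim i : cvg ((de k).2 0 i @[k --> F]).
  apply: (Flim _ 1); apply: nearW => k.
  have [_ [_ v1] _] := deP k.
  by rewrite -(ler_pXn2r (n := 2))// ?nnegrE// real_normK ?num_real// expr1n -v1
    coord_le_dot.
pose d q q' : R := lim ((de k).1 q q' @[k --> F]).
pose v : V := \row_i lim ((de k).2 0 i @[k --> F]).
have v_lim i : (de k).2 0 i @[k --> F] --> v 0 i by rewrite mxE; exact: vlim.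
have cst_lim (u : V) i : u 0 i @[k --> F] --> u 0 i by exact: cvg_cst.
have le_dlim (a : nat -> R) b q q' : a k @[k --> F] --> b ->
    (forall k, a k <= (de k).1 q q') -> b <= d q q'.
  by move=> ab le_a; apply: (ler_cvg_to ab (dlim q q')); exact: nearW.
have dlim_le (a : R) q q' : (forall k, (de k).1 q q' <= a) -> d q q' <= a.
  by move=> le_a; apply: (cvgr_to_le (dlim q q')); exact: nearW.
have dC q q' : d q q' = d q' q.
  by congr (lim (_ @ F)); apply/funext => k; have [[[dC _ _ _] _] _ _] := deP k.
have inv_cvg : (k.+1%:R : R)^-1 @[k --> F] --> 0.
  by move=> A A0; apply: ooF; exact: (@cvg_harmonic R).
exists v, width, d; split.
- exact: width_gt0.
- split.
    move=> i ij; apply: (@cvg_unique R _ (dot (de k).2 (e i) @[k --> F])) => //.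
      exact: cvg_dot.
    rewrite [X in X @ F](_ : _ = cst 0); first exact: cvg_cst.
    by apply/funext => k; have [_ [/(_ i ij) -> _] _] := deP k.
  apply: (@cvg_unique R _ (dot (de k).2 (de k).2 @[k --> F])) => //.
    exact: cvg_dot.
  rewrite [X in X @ F](_ : _ = cst 1); first exact: cvg_cst.
  by apply/funext => k; have [_ [_ ->] _] := deP k.
- split => [//|x y z|x y|x].
  + apply: (ler_cvg_to (dlim x z) (cvgD (dlim x y) (dlim y z))).
    by apply: nearW => k; have [[[_ dD _ _] _] _ _] := deP k; exact: dD.
  + apply/andP; split.
      apply: le_dlim; first exact: cvg_cst.
      by move=> k; have [[[_ _ /(_ x y)/andP[]]]] := deP k.
    by apply: dlim_le => k; have [[[_ _ /(_ x y)/andP[]]]] := deP k.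
  + apply: (@pairing_beaten_lim _ _ F (fun k i j => (de k).1 (x i) (x j))).
    * by move=> i l; exact: dlim.
    * by apply: nearW => k; have [[[_ _ _ ]]] := deP k.
- move=> i ij q q' oq oq'; apply/andP; split.
    apply: le_dlim; first exact: cvg_cst.
    by move=> k; have [[_ /(_ i ij q q' oq oq')/andP[]]] := deP k.
  by apply: dlim_le => k; have [[_ /(_ i ij q q' oq oq')/andP[]]] := deP k.
- move=> q q' oq oq'; apply/andP; split; last first.
    by apply: dlim_le => k; have [gd _ _] := deP k; exact: width_ub.
  (* The one-sided bound, applied also with the points exchanged, gives the absolute value. *)
  have lb p p' : orth e j p -> orth e j p' -> width * dot (p - p') v <= d p p'.
    move=> op op'; apply: (@le_dlim (fun k => width * dot (p - p') (de k).2 -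
      (1 + width * (dot p p + dot p' p') / 2) * k.+1%:R^-1)); last first.
      by move=> k; have [? ? ?] := deP k; exact: limit_bounds.
    rewrite -[X in _ --> X]subr0; apply: cvgB.
      by apply: cvgM; [exact: cvg_cst|exact: cvg_dot].
    rewrite -[X in _ --> X](mulr0 (1 + width * (dot p p + dot p' p') / 2)).
    by apply: cvgM; [exact: cvg_cst|].
  rewrite -[X in X * _]gtr0_norm ?width_gt0// -normrM ler_norml.
  rewrite lerNl -mulrN -dotNl opprB.
  by apply/andP; split; [rewrite dC; exact: lb|exact: lb].
Qed.

End flag_step.
(** Each step replaces the metric but preserves the bounds for the earlier directions. Appending
    [e j] is harmless because [orth e i] involves only indices below [i]. *)
Lemma exists_flag j d0 : (j <= m)%N -> hyperbolic_bilip d0 ->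
  exists e c d, [/\ hyperbolic_bilip d, flag_bounds e c j d &
    forall i, (i < j)%N -> [/\ 0 < c i, orth e i (e i) & dot (e i) (e i) = 1]].
Proof.
move=> jm d0_hyp; elim: j jm => [_|j ih jm].
  by exists (fun=> 0), (fun=> 0), d0; split=> // i; rewrite ltn0.
have [e [c [d [d_hyp d_flag ecP]]]] := ih (ltnW jm).
have [v [w [d' [w0 [ov v1] d'_hyp d'_flag d'_slab]]]] := flag_step jm d_hyp d_flag.
pose e' i := if i == j then v else e i; pose c' i := if i == j then w else c i.
have lt_neq i l : (i < l)%N -> (l <= j)%N -> (i == j) = false.
  by move=> il lj; apply/negbTE; rewrite neq_ltn (leq_trans il lj).
have orth' i q : (i <= j)%N -> orth e' i q <-> orth e i q.
  by move=> ij; split=> oq l li; have := oq l li; rewrite /e' (lt_neq l i).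
exists e', c', d'; split=> // i; rewrite ltnS leq_eqVlt => /orP[/eqP->|ij].
- move=> q q' /(orth' _ _ (leqnn j)) oq /(orth' _ _ (leqnn j)) oq'.
  by rewrite /e' /c' eqxx; exact: d'_slab.
- move=> q q' /(orth' _ _ (ltnW ij)) oq /(orth' _ _ (ltnW ij)) oq'.
  by rewrite /e' /c' (lt_neq i j)//; exact: d'_flag.
- by rewrite /c' eqxx {2 3 4}/e' eqxx; split => //; apply/(orth' _ _ (leqnn j)).
have [ci oi ei] := ecP i ij; rewrite /c' {2 3 4}/e' (lt_neq i j)//; split => //.
exact/(orth' _ _ (ltnW ij)).
Qed.

(* The points [+- e_k] with [e] a flag of length [n + 1] violate hyperbolicity:
   if [k] is the last index whose pair is not matched by [alpha], then moving
   [q] from [- s e_k] to [s e_k] changes [d q (x i) + d q (x (alpha i))] to first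
   order in [s], whereas all these sums agree with [d (x i) (x (alpha i))] up
   to second order. *)
Lemma not_hyperbolic_bilip d0 : (n < m)%N -> ~ hyperbolic_bilip d0.
Proof.
move=> nm /(exists_flag nm)[e [c [d [[dC dD _ d_hyp] d_flag ecP]]]].
pose sg (b : bool) : R := if b then 1 else -1.
pose x (i : sgn_index n) := sg i.2 *: e i.1.
have sgK b : sg b * sg b = 1 by case: b; rewrite /sg ?mulrNN mulr1.
have c0 (i : sgn_index n) : 0 < c i.1 by have [] := ecP i.1 (ltn_ord _).
have ox (i : sgn_index n) j : (j <= i.1)%N -> orth e j (x i).
  by move=> ji; apply/orthZ/(orth_leq ji); have [] := ecP i.1 (ltn_ord _).
have dot_e (i j : 'I_n.+1) : dot (e i) (e j) = (i == j)%:R.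
  have [->|/eqP ij] := eqVneq i j; first by have [] := ecP j (ltn_ord _).
  have [lt_ij|lt_ji|/val_inj//] := ssrnat.ltngtP i j.
    by rewrite dotC; have [_ oe _] := ecP j (ltn_ord _); rewrite oe.
  by have [_ oe _] := ecP i (ltn_ord _); rewrite oe.
have x_opp i : x i - x (sgn_opp i) = (2 * sg i.2) *: e i.1.
  by rewrite /x /= -scalerBl; congr (_ *: _); case: i.2; rewrite /sg/=; lra.
(* Along [e_k] the upper and the lower slab bound coincide. *)
have pair i : d (x i) (x (sgn_opp i)) = 2 * c i.1.
  have := d_flag i.1 (ltn_ord _) _ _ (ox i i.1 (leqnn _)) (ox (sgn_opp i) i.1 (leqnn _)).
  rewrite x_opp dotZl euclidean_normZ dot_e eqxx mulr1.
  rewrite euclidean_norm_unit ?dot_e ?eqxx// mulr1.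
  have -> : `|2 * sg i.2| = 2 by case: i.2; rewrite /sg ?mulrN1 ?mulr1 ?normrN ger0_norm.
  by rewrite [c i.1 * 2]mulrC => /le_anti.
have [alpha alphaN le_alpha] := d_hyp x.
have [i1 i1N] : exists i, alpha i != sgn_opp i.
  apply: contrapT => /forallNP alpha_opp; apply: alphaN; apply/permP => i.
  by rewrite permE; apply/eqP/negPn/negP; exact: alpha_opp.
case: (@arg_maxnP _ i1 (fun i => alpha i != sgn_opp i) (fun i => i.1 : nat) i1N).
move=> i0 i0N max_i0; set k := i0.1 in max_i0.
have alpha_opp (i : sgn_index n) : (k < i.1)%N -> alpha i = sgn_opp i.
  by move=> ki; apply/eqP; apply: contraTT ki => /max_i0; rewrite -leqNgt.
(* The indices above [k] are matched among themselves, so [alpha] preserves the rest. *)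
have alpha_le (i : sgn_index n) : (i.1 <= k)%N -> ((alpha i).1 <= k)%N.
  move=> ik; rewrite leqNgt; apply/negP => k_alpha.
  have /perm_inj ei : alpha (sgn_opp (alpha i)) = alpha i by rewrite alpha_opp ?sgn_oppK.
  have e1 : (alpha i).1 = i.1 by rewrite -[in RHS]ei.
  by rewrite e1 ltnNge ik in k_alpha.
(* An upper bound for the distance from [s e_k] to [x i] when [i.1 <= k], with [1 + s ^+ 2 / 2] in
   place of the square root of [1 + s ^+ 2]. Above [k] it is half the distance of the matched
   pair. *)
pose g (s : R) (i : sgn_index n) := if (i.1 < k)%N then c i.1 * (1 + s ^+ 2 / 2)
  else if i.1 == k then c i.1 * (1 - sg i.2 * s) else c i.1.
have dist_le_g (s : R) (i : sgn_index n) : `|s| <= 1 -> (i.1 <= k)%N ->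
    d (s *: e k) (x i) <= g s i.
  move=> s1 ik; have oek : orth e i.1 (s *: e k).
    by apply/orthZ/(orth_leq ik); have [] := ecP k (ltn_ord _).
  have /andP[_ le_d] := d_flag i.1 (ltn_ord _) _ _ oek (ox i i.1 (leqnn _)).
  rewrite (le_trans le_d)// /g; move: ik; rewrite leq_eqVlt => /orP[/eqP/val_inj ik|ik].
    rewrite /x ik ltnn eqxx ler_pM2l -?ik// -scalerBl euclidean_normZ.
    rewrite euclidean_norm_unit ?dot_e ?eqxx// mulr1.
    by move: s1; rewrite ler_norml; case: i.2; rewrite /sg ler_norml; lra.
  rewrite ik ler_pM2l// (le_trans (euclidean_norm_le _ ltr01))//.
  have ki : (k == i.1) = false by apply/eqP => ki; rewrite ki ltnn in ik.
  rewrite /x !dotE !dot_e !eqxx ki [i.1 == k]eq_sym ki /= le_eqVlt.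
  apply/orP; left; apply/eqP.
  by case: i.2; rewrite /sg; field.
have D_le_g (s : R) i : `|s| <= 1 -> d (x i) (x (alpha i)) <= g s i + g s (alpha i).
  move=> s1; have [ik|ki] := leqP i.1 k.
    rewrite (le_trans (dD _ (s *: e k) _))// (dC (x i)).
    by rewrite lerD// dist_le_g// alpha_le.
  rewrite alpha_opp// pair /g /= ltnNge (ltnW ki)/=.
  by rewrite (_ : i.1 == k = false) ?mulr_natl//; apply/eqP => ik; rewrite ik ltnn in ki.
pose C := \sum_(i : sgn_index n) c i.1.
(* The terms linear in [s] cancel between the two points of the pair [k]. *)
have sum_g (s : R) : \sum_i g s i <= C * (1 + s ^+ 2 / 2).
  rewrite /C !sum_sgn_index mulr_suml; apply: ler_sum => j _; rewrite /g /=.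
  have cj : 0 < c j := c0 (j, true).
  have cs : 0 <= c j * (s ^+ 2 / 2) by rewrite mulr_ge0 ?(ltW cj)// divr_ge0// sqr_ge0.
  by case: ifP => _; [lra|case: ifP => _; rewrite /sg; lra].
(* All defects are nonnegative, so each is at most their sum, which hyperbolicity bounds through
   [2 * C <= \sum_i d (x i) (x (alpha i))]. *)
have defect (s : R) i : `|s| <= 1 ->
    g s i + g s (alpha i) - d (x i) (x (alpha i)) <= s ^+ 2 * C.
  move=> s1; rewrite (@le_trans _ _
    (\sum_i (g s i + g s (alpha i) - d (x i) (x (alpha i)))))//.
    rewrite (bigD1 i)//= lerDl sumr_ge0// => j _.
    by rewrite subr_ge0 D_le_g.
  have sum_alpha : \sum_i g s (alpha i) = \sum_i g s i.
    by rewrite [RHS](reindex_inj (@perm_inj _ alpha)).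
  rewrite sumrB big_split/= sum_alpha.
  have -> : s ^+ 2 * C = 2 * (C * (1 + s ^+ 2 / 2)) - 2 * C by lra.
  have : 2 * C <= \sum_i d (x i) (x (alpha i)).
    apply: le_trans le_alpha; rewrite mulr_sumr; apply: ler_sum => j _.
    by rewrite pair.
  by have := sum_g s; lra.
have gk (s : R) : g s i0 = c k * (1 - sg i0.2 * s) by rewrite /g ltnn eqxx.
have ck0 : 0 < c k := c0 i0.
have [a0|a0] := eqVneq (alpha i0) i0.
  have := defect 0 i0; rewrite a0 gk normr0 ler01 => /(_ isT).
  have := ecP k (ltn_ord _) => -[_ _ _].
  have : d (x i0) (x i0) <= 0.
    have /andP[_] := d_flag k (ltn_ord _) _ _ (ox i0 k (leqnn _)) (ox i0 k (leqnn _)).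
    by rewrite subrr euclidean_norm0 mulr0.
  by rewrite expr2 !mulr0 mul0r; lra.
(* Only [i0] and [- i0] have index [k], and [alpha i0] is neither. *)
have lk : ((alpha i0).1 < k)%N.
  rewrite ltn_neqAle alpha_le// andbT; apply/negP => /eqP/val_inj lk.
  case: (alpha i0) lk i0N a0 => l b /= ->; rewrite /sgn_opp /k.
  by case: (i0) => l' []; case: b; rewrite /= eqxx.
(* With this [s] the defect bound [s ^+ 2 * C] is [c k * s], whereas passing from [s] to [- s]
   changes [g] at [i0] by [2 * c k * s]. *)
pose s := c k / C.
have cC : c k <= C by rewrite /C (bigD1 i0)//= lerDl sumr_ge0// => j _; exact: ltW.
have C0 : 0 < C by exact: lt_le_trans cC.
have s0 : 0 < s by rewrite divr_gt0.
have s1 (b : bool) : `|sg b * s| <= 1.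
  rewrite normrM (_ : `|sg b| = 1) ?mul1r; last by case: b; rewrite /sg ?normrN1 ?normr1.
  by rewrite gtr0_norm// ler_pdivrMr// mul1r.
have sC : s ^+ 2 * C = c k * s.
  by rewrite expr2 -mulrA [s * C]divfK ?gt_eqF// mulrC.
clearbody s; have sg2 b : (sg b * s) ^+ 2 = s ^+ 2 by rewrite exprMn expr2 sgK mul1r.
have := D_le_g (sg i0.2 * s) i0 (s1 _); have := defect (sg (~~ i0.2) * s) i0 (s1 _).
rewrite !gk /g lk !sg2 !mulrA sgK mul1r.
have -> : sg i0.2 * sg (~~ i0.2) = -1 by case: i0.2; rewrite /sg/=; lra.
have : 0 < c k * s by rewrite mulr_gt0.
by rewrite sC; lra.
Qed.

End flags.

(** * Porous sets *)

Section lebesgue_cubes.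
Context {R : realType}.
Local Notation RT m := (m.-tuple (measurableTypeR R)).

Definition tuple_cube m (a : 'I_m -> R) (s : R) : set (RT m) :=
  [set t | forall i, a i <= tnth t i <= a i + s].

Lemma measurable_tuple_cube m (a : 'I_m -> R) s : measurable (tuple_cube a s).
Proof.
rewrite (_ : tuple_cube a s = \bigcap_(i in [set: 'I_m])
    ((fun t : RT m => tnth t i) @^-1` `[a i, a i + s]%classic)).
  apply: fin_bigcap_measurable => // i _.
  rewrite -[X in measurable X]setTI; exact: measurable_tnth.
apply/seteqP; split=> t /= ct i; first by move=> _ /=; rewrite in_itv/=.
by have := ct i I; rewrite /= in_itv.
Qed.

Lemma lebesgue_tuple_cube m (a : 'I_m -> R) s : 0 <= s ->
  lebesgue_tuple m (tuple_cube a s) = (s ^+ m)%:E.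
Proof.
move=> s0; elim: m a => [|m ih] a.
  rewrite /= diracE mem_set// => -[].
  by case.
have -> : lebesgue_tuple m.+1 (tuple_cube a s) =
  (lebesgue_measure \x lebesgue_tuple m)%E
    (@tuple_cons R m @^-1` tuple_cube a s) by [].
rewrite (_ : _ @^-1` _ =
    `[a ord0, a ord0 + s]%classic `*` tuple_cube (a \o lift ord0) s); last first.
  apply/seteqP; split=> [[x t] /= ct|[x t] /= [cx ct] i].
    split; first by have := ct ord0; rewrite tnth0 in_itv.
    by move=> i; have := ct (lift ord0 i); rewrite /tuple_cons /= tnthS.
  case: (unliftP ord0 i) => [j ->|->]; first by rewrite /tuple_cons/= tnthS; exact: ct.
  by move: cx; rewrite tnth0 in_itv.
rewrite product_measure1E; [|exact: measurable_itv|exact: measurable_tuple_cube].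
rewrite ih exprS EFinM; congr (_ * _)%E.
apply: (etrans (lebesgue_measure_itv `[a ord0, a ord0 + s])).
rewrite /= lte_fin; case: ltP => [_|].
  by rewrite -EFinB addrAC subrr add0r.
by rewrite -lerBrDl subrr => s_le0; congr _%:E; apply/le_anti; rewrite s0 s_le0.
Qed.

Definition tuple_preimage m (K : set 'rV[R]_m) : set (RT m) :=
  [set t | K (\row_i tnth t i)].

(** A closed set is the intersection over [k] of the countable union of those cubes with rational
    centre and side [2 / k.+1] that meet it. *)
Lemma measurable_closed_preimage m (K : set 'rV[R]_m) : closed K ->
  measurable (tuple_preimage K).
Proof.
move=> cK; pose a (e : R) (q : 'rV[rat]_m) i : R := ratr (q 0 i) - e.
pose meets e q := exists u, K u /\ forall i, a e q i <= u 0 i <= a e q i + 2 * e.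
pose E e q := if `[< meets e q >] then tuple_cube (a e q) (2 * e) else set0.
have mE e q : measurable (E e q).
  by rewrite /E; case: ifP => _; [exact: measurable_tuple_cube|exact: measurable0].
suff -> : tuple_preimage K = \bigcap_k \bigcup_q E k.+1%:R^-1 q.
  by apply: bigcapT_measurable => k; apply: countable_bigcupT_measurable.
apply/seteqP; split=> t.
  move=> Kt k _; have : 0 < k.+1%:R^-1 :> R by rewrite invr_gt0.
  move: (k.+1%:R^-1) => e e0.
  have near_rat (i : 'I_m) : exists q : rat, `|ratr q - tnth t i| < e.
    have [|q] := @rat_in_itvoo R (tnth t i - e) (tnth t i + e).
      by rewrite ltrBlDr -addrA ltrDl addr_gt0.
    by rewrite in_itv/= -ltr_distl => qt; exists q.
  have [q qt] := choice near_rat.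
  have at_ i : a e (\row_j q j) i <= tnth t i <= a e (\row_j q j) i + 2 * e.
    by rewrite /a mxE; have := qt i; rewrite ltr_norml; lra.
  exists (\row_i q i) => //; rewrite /E; case: asboolP => //; case.
  by exists (\row_i tnth t i); split=> // i; rewrite mxE.
move=> Et; apply: cK => B /nbhs_ballP[e /= e0 eB].
have [k ke] : exists k, 2 * k.+1%:R^-1 < e.
  exists (Num.bound (2 / e)); rewrite ltr_pdivrMr// mulrC -ltr_pdivrMr//.
  apply: lt_le_trans (archi_boundP _) _; first by rewrite divr_ge0// ltW.
  by rewrite ler_nat.
have : 0 <= k.+1%:R^-1 :> R by rewrite invr_ge0.
have := Et k I; move: (k.+1%:R^-1) ke => h he [q _] + h0.
rewrite /E; case: asboolP => // -[u [Ku au]] at_.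
exists u; split=> //; apply: eB; rewrite -ball_normE /ball_/=.
apply: le_lt_trans he; apply: rV_norm_le => [|i]; first by rewrite mulr_ge0.
by rewrite !mxE ler_norml; have := au i; have := at_ i; lra.
Qed.

Lemma measure_bigsetU_le m (I : Type) (r : seq I) (P : pred I) (F : I -> set (RT m)) :
  (forall i, measurable (F i)) ->
  (lebesgue_tuple m (\big[setU/set0]_(i <- r | P i) F i) <=
   \sum_(i <- r | P i) lebesgue_tuple m (F i))%E.
Proof.
move=> mF; elim: r => [|i r ih]; first by rewrite !big_nil measure0.
rewrite !big_cons; case: ifP => // _.
apply: (le_trans (measureU2 _ (mF i) _)).
  by apply: bigsetU_measurable.
by rewrite leeD2l.
Qed.

Lemma exists_step (N : nat) (s y : R) : 0 <= y -> y <= s * N.+1%:R ->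
  exists k : 'I_N.+1, s * k%:R <= y <= s * k%:R + s.
Proof.
move=> y0; elim: N => [|N ih] yN.
  by exists ord0; rewrite mulr0 y0 add0r -[s in leRHS]mulr1.
have [/ih[k ky]|Ny] := leP y (s * N.+1%:R); first by exists (widen_ord (leqnSn _) k).
by exists ord_max; rewrite (ltW Ny)/= -[X in _ + X]mulr1 -mulrDr natr1.
Qed.

(** Of the [M] equal subcubes of any cube one misses [K], so each subdivision multiplies the bound
    on the measure of [K] in the cube by [theta = (M - 1) / M < 1]. *)
Lemma porous_null m (K : set 'rV[R]_m) (N : nat) : compact K ->
  (forall (a : 'I_m -> R) s, 0 < s -> exists p : {ffun 'I_m -> 'I_N.+1},
    forall z, K z -> ~ forall i, a i + s * (p i)%:R <= z 0 i <= a i + s * (p i)%:R + s) ->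
  lebesgue_Rn K = 0%E.
Proof.
move=> cK holes; pose tK := tuple_preimage K.
have mtK : measurable tK.
  by apply: measurable_closed_preimage; apply: compact_closed => //; exact: norm_hausdorff.
pose M : R := N.+1%:R ^+ m; pose theta := (M - 1) / M.
have M1 : 1 <= M by rewrite exprn_ege1// ler1n.
have M0 : 0 < M by exact: lt_le_trans M1.
have theta0 : 0 <= theta by rewrite divr_ge0 ?subr_ge0// ltW.
have theta1 : theta < 1 by rewrite ltr_pdivrMr// mul1r gtrBl.
have thetaM : theta * M = M - 1 by rewrite divfK ?gt_eqF.
clearbody theta; have shrink j a s : 0 < s ->
    (lebesgue_tuple m (tK `&` tuple_cube a s) <= (theta ^+ j * s ^+ m)%:E)%E.
  elim: j a s => [|j ih] a s s0.
    rewrite expr0 mul1r -(lebesgue_tuple_cube a (ltW s0)) le_measure ?inE//.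
    - by apply: measurableI => //; exact: measurable_tuple_cube.
    - exact: measurable_tuple_cube.
  pose s' := s / N.+1%:R; have s'0 : 0 < s' by rewrite divr_gt0.
  have [p0 p0P] := holes a s' s'0.
  pose a' (p : {ffun 'I_m -> 'I_N.+1}) i := a i + s' * (p i)%:R.
  have mF p : measurable (tK `&` tuple_cube (a' p) s').
    by apply: measurableI => //; exact: measurable_tuple_cube.
  have sub : tK `&` tuple_cube a s `<=`
      \big[setU/set0]_(p | p != p0) (tK `&` tuple_cube (a' p) s').
    move=> t [Kt ct].
    have step i : exists k : 'I_N.+1, s' * k%:R <= tnth t i - a i <= s' * k%:R + s'.
      by apply: exists_step; [|rewrite /s' divfK//]; have := ct i; lra.
    have [p pP] := choice step.
    have ctp : tuple_cube (a' (finfun p)) s' t.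
      by move=> i; rewrite /a' ffunE; have := pP i; lra.
    rewrite -bigcup_seq_cond; exists (finfun p); last by split.
    rewrite /= mem_index_enum/=; apply: contra_notN (p0P _ Kt) => /eqP <- i.
    by rewrite mxE; exact: ctp.
  have mS : measurable (\big[setU/set0]_(p | p != p0) (tK `&` tuple_cube (a' p) s')).
    exact: bigsetU_measurable.
  rewrite (le_trans (le_measure _ _ _ sub)) ?inE//.
    by apply: measurableI => //; exact: measurable_tuple_cube.
  rewrite (le_trans (measure_bigsetU_le _ _ mF))//.
  rewrite (@le_trans _ _ (\sum_(p : {ffun 'I_m -> 'I_N.+1} | p != p0)
      (theta ^+ j * s' ^+ m)%:E)%E)//; first by apply: lee_sum => p _; exact: ih.
  rewrite sumEFin lee_fin sumr_const.
  have -> : #|[pred p | p != p0]| = (N.+1 ^ m).-1.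
    by rewrite cardC1 card_ffun !card_ord.
  rewrite -[leLHS]mulr_natr -subn1 natrB ?expn_gt0// natrX -/M.
  rewrite -thetaM [s' ^+ m]expr_div_n -/M exprSr le_eqVlt; apply/orP; left.
  by apply/eqP; field; rewrite gt_eqF.
apply/le_anti/andP; split; last exact: measure_ge0.
have [B [_ KB]] := compact_bounded cK.
pose b : R := Num.max B 0 + 1.
have b0 : 0 < b by rewrite ltr_pwDr// le_max lexx orbT.
have Kb u i : K u -> - b <= u 0 i <= b.
  move=> Ku; rewrite -ler_norml (le_trans (coord_le_norm u i))//.
  by apply: (KB b) => //; rewrite /b ltr_pwDr// le_max lexx.
have Ksub : tK = tK `&` tuple_cube (fun=> - b) (2 * b).
  apply/seteqP; split=> [t Kt|t []//]; split=> // i.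
  by have := Kb _ i Kt; rewrite mxE; lra.
have lim0 : theta ^+ j * (2 * b) ^+ m @[j --> \oo] --> 0.
  rewrite -(mul0r ((2 * b) ^+ m)); apply: cvgM; last exact: cvg_cst.
  by apply: cvg_expr; rewrite ger0_norm.
have le_theta j : (lebesgue_Rn K <= (theta ^+ j * (2 * b) ^+ m)%:E)%E.
  by rewrite /lebesgue_Rn -/(tuple_preimage K) -/tK Ksub shrink// mulr_gt0.
move: le_theta; have := @measure_ge0 _ _ _ (lebesgue_tuple m) tK.
rewrite -/(lebesgue_Rn K); case: (lebesgue_Rn K) => [r| |] //; last by move=> _ /(_ 0%N).
move=> _ le_theta; rewrite lee_fin; apply: (cvgr_to_ge lim0).
by apply: nearW => j; have := le_theta j; rewrite lee_fin.
Qed.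

End lebesgue_cubes.

(* Cutting out ever finer and ever wider grids that are filled up to one mesh by
   [K] and rescaling them turns the metric of [Z] into a metric on the whole
   space. *)
Lemma exists_hyperbolic_bilip (R : realType) (Z : metricType R) (m n : nat)
    (K : set 'rV[R]_m) (f : Z -> 'rV[R]_m) (L : R) :
  compact K -> (0 < lebesgue_Rn K)%E -> f @` [set: Z] = K -> 0 < L ->
  (forall x y, L^-1 * mdist x y <= euclidean_norm (f x - f y) <= L * mdist x y) ->
  (forall x : sgn_index n -> Z, pairing_beaten (fun i j => mdist (x i) (x j))) ->
  exists d, @hyperbolic_bilip R m n L d.
Proof.
move=> cK K0 fK L0 fL Zhyp.
(* If every cube had an empty cell at this mesh, [K] would be null. The [2 * k.+1 ^ 2] steps cover
   [[-T, T]] with mesh [1 / T] for [T = k.+1]. *)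
have grid k : exists c : ('I_m -> R) * R, 0 < c.2 /\
    forall p : {ffun 'I_m -> 'I_(2 * k.+1 ^ 2).+1}, exists z : Z, forall i,
      c.1 i + c.2 * (p i)%:R <= f z 0 i <= c.1 i + c.2 * (p i)%:R + c.2.
  apply: contrapT => noc.
  suff K00 : lebesgue_Rn K = 0%E by rewrite K00 ltxx in K0.
  apply: (@porous_null _ _ _ (2 * k.+1 ^ 2)) => // a s s0.
  apply: contrapT => nop; apply: noc; exists (a, s); split=> //= p.
  apply: contrapT => noz; apply: nop; exists p => u; rewrite -fK => -[z _ <-] uP.
  by apply: noz; exists z.
have [c cP] := choice grid.
pose T k : R := k.+1%:R.
have T0 k : 0 < T k by [].
(* The grid coordinate [T x_i + T ^ 2] ranges over [[0, 2 T ^ 2]]; for [x] outside the range any [z]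
   does. *)
have pick_z k (x : 'rV[R]_m) : exists z : Z, (forall i, `|x 0 i| <= T k) ->
    forall i, `|f z 0 i - (c k).1 i - (c k).2 * (T k * x 0 i + T k ^+ 2)| <= (c k).2.
  have [xT|?] := pselect (forall i, `|x 0 i| <= T k); last first.
    by have [_ /(_ [ffun=> ord0])[z _]] := cP k; exists z.
  have cell i : exists p : 'I_(2 * k.+1 ^ 2).+1,
      1 * p%:R <= T k * x 0 i + T k ^+ 2 <= 1 * p%:R + 1.
    have : (2 * k.+1 ^ 2)%:R = 2 * T k ^+ 2 by rewrite natrM natrX.
    have := xT i; move: (T k) (T0 k) => t t0 xt Nt.
    move: xt; rewrite ler_norml => /andP[/(ler_wpM2l (ltW t0)) xl /(ler_wpM2l (ltW t0)) xu].
    apply: exists_step; first by rewrite expr2; lra.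
    by rewrite mul1r -natr1 Nt expr2; lra.
  have [p pP] := choice cell; have [c0 /(_ (finfun p))[z zP]] := cP k.
  exists z => _ i; have /andP[] := pP i; rewrite !mul1r => lep leP.
  have := zP i; rewrite ffunE ler_norml.
  have := ler_wpM2l (ltW c0) lep; have := ler_wpM2l (ltW c0) leP.
  by move: (_ + T k ^+ 2) => y; lra.
have [z1 z1P] := choice (fun kx : nat * 'rV[R]_m => pick_z kx.1 kx.2).
pose z0 k x := z1 (k, x); have z0P k x := z1P (k, x).
pose scale k := (c k).2 * T k.
have scale0 k : 0 < scale k by rewrite mulr_gt0//; have [] := cP k.
pose w k x y := (scale k)^-1 *: (f (z0 k x) - f (z0 k y)).
pose dk k x y := mdist (z0 k x) (z0 k y) / scale k.
have large (x : 'rV[R]_m) : \forall k \near \oo, forall i, `|x 0 i| <= T k.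
  exists (Num.bound `|x|) => // k /= xk i; rewrite (le_trans (coord_le_norm x i))//.
  apply/ltW/(lt_le_trans (archi_boundP (normr_ge0 _))).
  by rewrite ler_nat; exact: leqW.
(* Each of the two points is off by at most one mesh, which is [1 / T] after division by
   [scale k]. *)
have wcvg x y i : w k x y 0 i @[k --> \oo] --> (x - y) 0 i.
  have dist_cvg : 2 * (T k)^-1 @[k --> \oo] --> 0.
    by rewrite -(mulr0 2); apply: cvgM; [exact: cvg_cst|exact: cvg_harmonic].
  apply/cvgrPdist_le => e e0.
  have small : \forall k \near \oo, 2 * (T k)^-1 <= e by exact: (cvgr_le 0).
  apply: filterS3 (large x) (large y) small => k xk yk; apply: le_trans.
  have := z0P k x xk i; have := z0P k y yk i; have [c0 _] := cP k.
  have -> : (x - y) 0 i - w k x y 0 i = ((scale k)^-1) *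
     ((f (z0 k y) 0 i - (c k).1 i - (c k).2 * (T k * y 0 i + T k ^+ 2)) -
      (f (z0 k x) 0 i - (c k).1 i - (c k).2 * (T k * x 0 i + T k ^+ 2))).
    by rewrite !mxE /scale; field; rewrite !gt_eqF.
  rewrite normrM gtr0_norm ?invr_gt0// ler_pdivrMl// => ley lex.
  rewrite (le_trans (ler_normB _ _))// (le_trans (lerD ley lex))//.
  by rewrite /scale mulrCA mulfK ?gt_eqF// mulr_natl mulr2n.
have norm_cvg x y : euclidean_norm (w k x y) @[k --> \oo] --> euclidean_norm (x - y).
  by apply: cvg_euclidean_norm => i; exact: wcvg.
have dk_bounds k x y :
    L^-1 * euclidean_norm (w k x y) <= dk k x y <= L * euclidean_norm (w k x y).
  have /andP[le1 le2] := fL (z0 k x) (z0 k y).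
  rewrite /w /dk euclidean_normZ gtr0_norm ?invr_gt0// -![_ / scale k]mulrC.
  rewrite ![_ * ((scale k)^-1 * _)]mulrCA !ler_pM2l ?invr_gt0//.
  by rewrite ler_pdivrMl// le2/= -ler_pdivrMl.
have [F [FF ooF Flim]] := ultrafilter_limits R.
have toF (u : nat -> R) (l : R) : u k @[k --> \oo] --> l -> u k @[k --> F] --> l.
  by move=> ul A /ul; exact: ooF.
have dlim x y : cvg (dk k x y @[k --> F]).
  apply: (Flim _ (L * (euclidean_norm (x - y) + 1))).
  have lt_norm : euclidean_norm (x - y) < euclidean_norm (x - y) + 1 by rewrite ltrDl.
  have : \forall k \near \oo, euclidean_norm (w k x y) <= euclidean_norm (x - y) + 1.
    exact: (cvgr_le (euclidean_norm (x - y))).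
  apply: filterS => k le_w; have /andP[_ le_d] := dk_bounds k x y.
  rewrite ger0_norm; last by rewrite divr_ge0 ?mdist_ge0// ltW.
  by rewrite (le_trans le_d)// ler_pM2l.
exists (fun x y => lim (dk k x y @[k --> F])); split.
- by move=> x y; congr (lim (_ @ F)); apply/funext => k; rewrite /dk metric_sym.
- move=> x y z; apply: (ler_cvg_to (dlim x z) (cvgD (dlim x y) (dlim y z))).
  apply: nearW => k; rewrite /dk -[leRHS]mulrDl ler_pM2r ?invr_gt0//.
  exact: metric_triangle.
- move=> x y; have cvgL (a : R) :
      a * euclidean_norm (w k x y) @[k --> F] --> a * euclidean_norm (x - y).
    by apply: cvgM; [exact: cvg_cst|exact/toF/norm_cvg].
  apply/andP; split.
    by apply: (ler_cvg_to (cvgL _) (dlim x y)); apply: nearW => k;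
      have /andP[] := dk_bounds k x y.
  by apply: (ler_cvg_to (dlim x y) (cvgL _)); apply: nearW => k;
      have /andP[] := dk_bounds k x y.
- move=> x; apply: (@pairing_beaten_lim _ _ F (fun k i j => dk k (x i) (x j))).
    by move=> i j; exact: dlim.
  apply: nearW => k; have [alpha alphaN le_alpha] := Zhyp (fun i => z0 k (x i)).
  by exists alpha => //; rewrite -!mulr_suml ler_pM2r ?invr_gt0.
Qed.

(** * Asymptotic subsets *)

Section asymptotic_subsets.
Context {R : realType} (n : nat).

(** In a common ambient space every [x i] has a point of [A] within distance [e]; moving both ends
    of a pair costs at most [2 * e]. *)
Lemma gh_dist_lt_approx (Y Z : metricType R) (A : set Y) (I : Type) (x : I -> Z)
    (e : R) : (gh_dist A [set: Z] < e%:E)%E ->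
  exists y : I -> Y, forall i j, `|mdist (y i) (y j) - mdist (x i) (x j)| <= 2 * e.
Proof.
move=> /ereal_inf_lt[_ [W [f [g [fiso giso ->]]]] /ereal_inf_lt[_ [e' [e'0 _ sub]] <-]].
rewrite lte_fin => e'e.
have near_x i : exists y, A y /\ mdist (f y) (g (x i)) < e'.
  have [|_ [y Ay <-]] := sub (g (x i)); first by exists (x i).
  by rewrite ballEmdist => fy; exists y.
have [y yP] := choice near_x; exists y => i j.
have [Ai fi] := yP i; have [Aj fj] := yP j.
rewrite -(fiso _ _ Ai Aj) -(giso (x i) (x j))// ler_norml.
have := metric_triangle (f (y i)) (g (x i)) (f (y j)).
have := metric_triangle (g (x i)) (g (x j)) (f (y j)).
have := metric_triangle (g (x i)) (f (y i)) (g (x j)).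
have := metric_triangle (f (y i)) (f (y j)) (g (x j)).
rewrite (metric_sym (g (x j)) (f (y j))) (metric_sym (g (x i)) (f (y i))).
by lra.
Qed.

(** Rescaling divides the hyperbolicity constant by [r k], so it vanishes in the limit. *)
Lemma pairing_beaten_asymptotic (Y Z : metricType R) :
  star_hyperbolic n Y -> asymptotic_subset Y Z ->
  forall x : sgn_index n -> Z, pairing_beaten (fun i j => mdist (x i) (x j)).
Proof.
move=> [delta delta0 hypY] [_ [r [A [r_oo gh0]]]] x.
apply: pairing_beaten_approx => eta eta0.
pose N : R := #|sgn_index n|%:R.
have N0 : 0 < N by rewrite ltr0n; apply/card_gt0P; exists (ord0, true).
(* Two comparisons of sums with error [2 * e] per entry cost [eta / 2] in total; the other half pays
   for the rescaled [2 * delta]. *)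
have [e e0 eN] : exists2 e : R, 0 < e & e * N = eta / 8.
  by exists (eta / 8 / N); rewrite ?divr_gt0// divfK ?gt_eqF.
have gh_small : \forall k \near \oo,
    (gh_dist (A k : set (rescaled (r k) Y)) [set: Z] < e%:E)%E.
  exact: (gh0 _ (nbhs_open_ereal_lt (f := fun=> e) e0)).
have r_large : \forall k \near \oo, 4 * delta / eta <= (r k)%:num.
  exact: (cvgry_ge r_oo).
have [k [{}r_large {}gh_small]] := filter_ex (filterI r_large gh_small).
have [y yP] := gh_dist_lt_approx x gh_small.
have [alpha alphaN le_alpha] := hypY y; exists alpha => //.
have sumN (a : R) : \sum_(i : sgn_index n) a = a * N.
  by rewrite sumr_const -[LHS]mulr_natr.
pose D i j := @mdist R (rescaled (r k) Y) (y i) (y j).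
have DP i j : `|D i j - mdist (x i) (x j)| <= 2 * e by exact: yP.
have D_alpha : \sum_i D i (sgn_opp i) <= \sum_i D i (alpha i) + eta / 2.
  have DE i j : D i j = (r k)%:num^-1 * @mdist R Y (y i) (y j) by [].
  under eq_bigr do rewrite DE; under [in leRHS]eq_bigr do rewrite DE.
  rewrite -!mulr_sumr ler_pdivrMl// mulrDr mulVKf ?gt_eqF//.
  rewrite (le_trans le_alpha)// lerD2l.
  by move: r_large; rewrite ler_pdivrMr//; lra.
have le1 : \sum_i mdist (x i) (x (sgn_opp i)) <= \sum_i (D i (sgn_opp i) + 2 * e).
  by apply: ler_sum => i _; have := DP i (sgn_opp i); rewrite ler_norml; lra.
have le2 : \sum_i D i (alpha i) <= \sum_i (mdist (x i) (x (alpha i)) + 2 * e).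
  by apply: ler_sum => i _; have := DP i (alpha i); rewrite ler_norml; lra.
rewrite big_split/= sumN in le1; rewrite big_split/= sumN in le2.
by rewrite -mulrA eN in le1 le2; lra.
Qed.

Lemma asrk_le_of_star_hyperbolic (Y : metricType R) :
  star_hyperbolic n Y -> (asrk Y <= n%:R%:E)%E.
Proof.
move=> hypY; apply: ge_ereal_sup => _ [m /= [Z [K [asZ cK K0 [f [fK [L L0 fL]]]]]] <-].
rewrite lee_fin ler_nat leqNgt; apply/negP => nm.
have Zhyp := pairing_beaten_asymptotic hypY asZ.
have [d d_hyp] := exists_hyperbolic_bilip cK K0 fK L0 fL Zhyp.
exact: (not_hyperbolic_bilip L0 nm d_hyp).
Qed.

End asymptotic_subsets.

(** * The unit cube as an asymptotic subset *)

Record unit_cube (R : realType) (m : nat) := UnitCube {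
  cube_val :> 'rV[R]_m ;
  cube_bound : forall i, -1 <= cube_val 0 i <= 1 }.

Section unit_cube_metric.
Context {R : realType} (m : nat).
Local Notation cube := (unit_cube R m).

HB.instance Definition _ := gen_eqMixin cube.
HB.instance Definition _ := gen_choiceMixin cube.

Definition cube_dist (u v : cube) : R := `|cube_val u - cube_val v|.

Lemma cube_val_inj : injective (@cube_val R m).
Proof.
move=> [u cu] [v cv] /= uv; rewrite uv in cu *.
by congr UnitCube; exact: Prop_irrelevance.
Qed.

Lemma cube_distxx u : cube_dist u u = 0.
Proof. by rewrite /cube_dist subrr normr0. Qed.

Lemma cube_dist_positivity u v : cube_dist u v = 0 -> u = v.
Proof. by move=> /eqP; rewrite normr_eq0 subr_eq0 => /eqP/cube_val_inj. Qed.

Lemma cube_dist_sym u v : cube_dist u v = cube_dist v u.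
Proof. exact: distrC. Qed.

Lemma cube_dist_triangle v u w : cube_dist u w <= cube_dist u v + cube_dist v w.
Proof. exact: ler_distD. Qed.

HB.instance Definition _ := isMetric.Build R cube
  cube_distxx cube_dist_positivity cube_dist_sym cube_dist_triangle.

Let clamp (t : R) := Num.max (-1) (Num.min 1 t).

Let clamp_bound (u : 'rV[R]_m) i : -1 <= (\row_j clamp (u 0 j)) 0 i <= 1.
Proof.
rewrite mxE /clamp le_max lexx ge_max ge_min lexx /=.
by rewrite andbT (le_trans (lerN10 R) ler01).
Qed.

Let to_cube u : cube := UnitCube (clamp_bound u).

Let clamp_lip s t : `|clamp s - clamp t| <= `|s - t|.
Proof.
have clampP r : [\/ r <= -1 /\ clamp r = -1, -1 <= r <= 1 /\ clamp r = r |
    1 <= r /\ clamp r = 1].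
  rewrite /clamp; have [r1|/ltW r1] := leP 1 r.
    by rewrite max_r ?(le_trans (lerN10 R) ler01)//; constructor 3.
  have [r2|/ltW r2] := leP (-1) r; first by constructor 2; rewrite r1.
  by constructor 1.
have := ler_norm (s - t); have := ler_norm (- (s - t)); rewrite normrN.
by case: (clampP s) => -[? ->]; case: (clampP t) => -[? ->]; rewrite ler_norml; lra.
Qed.

Definition cube_image : set 'rV[R]_m := [set u | forall i, -1 <= u 0 i <= 1].

Lemma compact_cube_image : compact cube_image.
Proof.
rewrite (_ : cube_image =
    [set u : 'rV[R]_m | forall i, (fun=> `[-1, 1]%classic) i (u ord0 i)]).
  by apply: (@rV_compact R m (fun=> `[-1, 1]%classic)) => _; exact: segment_compact.
by apply/seteqP; split=> u cu i; have := cu i; rewrite /= in_itv.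
Qed.

(** Compactness is carried over from the cube in ['rV_m] by the 1-Lipschitz coordinatewise
    clamping. *)
Lemma compact_unit_cube : compact [set: cube].
Proof.
rewrite (_ : [set: cube] = to_cube @` cube_image).
  apply: continuous_compact; last exact: compact_cube_image.
  apply: continuous_subspaceT => u B /nbhs_ballP[e /= e0 eB].
  apply/nbhs_ballP; exists e => //= v; rewrite -ball_normE /ball_/= => uv.
  apply: eB; rewrite ballEmdist /=; apply: le_lt_trans uv.
  apply: rV_norm_le => // i; rewrite !mxE.
  by have := coord_le_norm (u - v) i; rewrite !mxE; exact/le_trans/clamp_lip.
apply/seteqP; split=> // u _; exists (cube_val u); first exact: cube_bound.
apply: cube_val_inj; apply/rowP => i; rewrite mxE /clamp.
have /andP[ul uu] := cube_bound u i.
by rewrite min_r// max_r.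
Qed.

Lemma lebesgue_Rn_cube_image : (0 < lebesgue_Rn cube_image)%E.
Proof.
rewrite /lebesgue_Rn (_ : [set t | _] = tuple_cube (fun=> -1) 2).
  by rewrite lebesgue_tuple_cube// lte_fin exprn_gt0.
apply/seteqP; split=> t ct i; have := ct i; rewrite ?mxE; lra.
Qed.

Lemma bilipschitz_unit_cube : bilipschitz_homeomorphic cube cube_image.
Proof.
exists (@cube_val R m); split.
  apply/seteqP; split=> [_ [u _ <-]|u cu]; first exact: cube_bound.
  by exists (UnitCube cu).
(* The Euclidean norm is at most the square root of [m] times the maximum norm; [m.+1] is larger and
   positive even for [m = 0]. *)
exists m.+1%:R => // u v; set w := cube_val u - cube_val v.
rewrite -[mdist u v]/(`|w|); apply/andP; split.
  rewrite ler_pdivrMl// (@le_trans _ _ (euclidean_norm w))//.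
    apply: rV_norm_le => [|i]; first exact: euclidean_norm_ge0.
    rewrite -(ler_pXn2r (n := 2))// ?nnegrE ?euclidean_norm_ge0//.
    by rewrite sqr_euclidean_norm real_normK ?num_real// coord_le_dot.
  by rewrite ler_peMl ?euclidean_norm_ge0// ler1n.
rewrite -(ler_pXn2r (n := 2))// ?nnegrE ?euclidean_norm_ge0 ?mulr_ge0//.
rewrite sqr_euclidean_norm (@le_trans _ _ (\sum_(i < m) `|w| ^+ 2))//.
  apply: ler_sum => i _; rewrite -expr2 -real_normK ?num_real//.
  by rewrite ler_pXn2r// ?nnegrE// coord_le_norm.
rewrite sumr_const card_ord -[leLHS]mulr_natl exprMn ler_wpM2r ?sqr_ge0//.
by rewrite -natrX ler_nat (leq_trans (leqnSn m))// expnS expn1 leq_pmulr.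
Qed.

(** A ball of radius [r], rescaled by [r], is isometric to the unit cube, so the Gromov-Hausdorff
    distances are exactly 0. *)
Lemma asymptotic_unit_cube (Y : metricType R) :
  (forall r0 : R, exists r, r0 < r /\ contains_linfty_ball m r Y) ->
  asymptotic_subset Y cube.
Proof.
move=> balls; split; first exact: compact_unit_cube.
have radii (k : nat) : exists r : {posnum R}, k%:R < r%:num /\
    contains_linfty_ball m r%:num Y.
  have [r [kr rY]] := balls k%:R.
  have r0 : 0 < r by exact: le_lt_trans kr.
  by exists (PosNum r0).
have [r rP] := choice radii.
have [F FP] := choice (fun k => (rP k).2).
pose A k := F k @` [set u : 'rV[R]_m | forall i, - (r k)%:num <= u 0 i <= (r k)%:num].
exists r, A; split.
  apply/cvgryPge => M; exists (Num.bound `|M|) => // k /= Mk.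
  apply/ltW/(le_lt_trans _ (rP k).1).
  by rewrite (le_trans (ler_norm M))// ltW// (lt_le_trans (archi_boundP _)) ?ler_nat.
rewrite (_ : (fun k => _) = fun=> 0%E); first exact: cvg_cst.
apply/funext => k; apply/le_anti/andP; split; last first.
  apply: le_ereal_inf_tmp => _ [W [f [g [_ _ ->]]]].
  apply: le_ereal_inf_tmp => _ [e [e0 _ _] <-].
  by rewrite lee_fin ltW.
pose g (z : cube) : rescaled (r k) Y := F k ((r k)%:num *: cube_val z).
have r0 : 0 < (r k)%:num by [].
have in_ball (z : cube) i : - (r k)%:num <= ((r k)%:num *: cube_val z) 0 i <= (r k)%:num.
  rewrite mxE -ler_norml normrM gtr0_norm// ler_piMr// ler_norml.
  exact: cube_bound.
have img : @idfun (rescaled (r k) Y) @` A k = g @` [set: cube].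
  rewrite image_id; apply/seteqP; split=> [_ [u ur <-]|_ [z _ <-]]; last first.
    by exists ((r k)%:num *: cube_val z).
  have cu i : -1 <= ((r k)%:num^-1 *: u) 0 i <= 1.
    by rewrite mxE ler_pdivlMl// ler_pdivrMl// mulr1 mulrN1.
  by exists (UnitCube cu) => //; rewrite /g /= scalerA divff ?gt_eqF// scale1r.
(* The rescaled space itself serves as the ambient space, where both images are the same set. *)
apply: (@le_trans _ _ (hausdorff_dist (@idfun (rescaled (r k) Y) @` A k)
    (g @` [set: cube]))).
  apply: ereal_inf_lbound; exists (rescaled (r k) Y), idfun, g; split => //.
  move=> z z' _ _; rewrite /mdist /= /rescaled_dist FP => [|i|i]; [|exact: in_ball..].
  by rewrite -scalerBr normrZ gtr0_norm// mulKf ?gt_eqF.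
rewrite img; apply/lee_addgt0Pr => e e0; rewrite add0e.
apply: ereal_inf_lbound; exists e => //; split=> // y gy; exists y => //;
  exact: ballxx.
Qed.

End unit_cube_metric.

Lemma no_cube_of_asrk_le (R : realType) (Y : metricType R) (n : nat) :
  (asrk Y <= n%:R%:E)%E -> exists r0 : R, forall r, r0 < r ->
    ~ contains_linfty_ball n.+1 r Y.
Proof.
move=> asrk_le; apply: contrapT => /forallNP balls.
suff : (n.+1%:R%:E <= asrk Y)%E.
  by move=> /le_trans/(_ asrk_le); rewrite lee_fin ler_nat ltnn.
apply: ereal_sup_ubound; exists n.+1 => //.
exists (unit_cube R n.+1), (@cube_image R n.+1); split.
- apply: asymptotic_unit_cube => r0; apply: contrapT => /forallNP no_ball.
  by apply: (balls r0) => r r0r rY; apply: (no_ball r).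
- exact: compact_cube_image.
- exact: lebesgue_Rn_cube_image.
- exact: bilipschitz_unit_cube.
Qed.

Theorem theorem1p2 (R : realType) (X : metricType R) (n : nat) :
  [/\ star_hyperbolic n X <-> star_hyperbolic n (injective_hull X),
      star_hyperbolic n (injective_hull X) <->
        (asrk (injective_hull X) <= n%:R%:E)%E
    & (asrk (injective_hull X) <= n%:R%:E)%E <->
        exists r0 : R, forall r : R, r0 < r ->
          ~ contains_linfty_ball n.+1 r (injective_hull X)].
Proof.
(* The implications form the cycle (2), (3), (4), (1), (2), completed by (2) to (1). *)
have hull_asrk := @asrk_le_of_star_hyperbolic R n (injective_hull X).
have asrk_cube := @no_cube_of_asrk_le R (injective_hull X) n.
have cube_X := @star_hyperbolic_of_no_cube R X n.
have X_hull := @star_hyperbolic_hull R X n.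
by split; split; [exact: X_hull|exact: star_hyperbolic_of_hull|exact: hull_asrk|
  move=> /asrk_cube/cube_X/X_hull|exact: asrk_cube|move=> /cube_X/X_hull/hull_asrk].
Qed.
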